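(* Let $A$ be a matrix over a field $\mathbb{F}$ with at least one column. Then the smallest incidence tree-depth of a matrix equivalent to $A$ equals the contraction$^*$-deletion-depth of the column matroid of $A$ plus one, i.e., $\mathrm{td}_I^*(A)=\mathrm{csdd}(M(A))+1$.
   Context: Two matrices are equivalent if one can be obtained from the other by a finite sequence of row operations: adding a multiple of one row to another row, and multiplying a row by a nonzero scalar. For a graph $G$, the tree-depth $\mathrm{td}(G)$ is the minimum height of a rooted forest $F$ on $V(G)$ such that every edge of $G$ joins a vertex to one of its ancestors in $F$; the height of a rooted forest is the maximum number of vertices on a root-to-leaf path. The incidence graph of a matrix $A$ is the bipartite graph whose vertices are the rows and the columns of $A$, a row $r$ being adjacent to a column $c$ iff the entry of $A$ in row $r$ and column $c$ is non-zero; $\mathrm{td}_I(A)$ is its tree-depth and $\mathrm{td}_I^*(A)$ is the minimum of $\mathrm{td}_I(A')$ over all matrices $A'$ equivalent to $A$. The column matroid $M(A)$ of an $m$-row matrix is the represented matroid whose elements are the columns of $A$, viewed as vectors of $\mathbb{F}^m$, independence being linear independence. A loop is an element represented by the zero vector; the rank of the matroid is the dimension of the span of its vectors. A circuit is a minimal dependent set; a matroid is connected if every two distinct elements lie in a common circuit; components are maximal connected restrictions. For an element $e$, $M\setminus e$ is obtained by removing $e$. For a one-dimensional subspace $L$ of $\mathbb{F}^m$, $M/L$ is the represented matroid with the same elements whose vectors are the images in the quotient space $\mathbb{F}^m/L$. The contraction$^*$-deletion-depth $\mathrm{csdd}(M)$ is defined recursively: if $M$ has rank zero, $\mathrm{csdd}(M)=0$;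 if $M$ consists of a single non-loop element, $\mathrm{csdd}(M)=1$; if $M$ is not connected, $\mathrm{csdd}(M)$ is the maximum of $\mathrm{csdd}$ over the components of $M$; otherwise $\mathrm{csdd}(M)$ is $1$ plus the smaller of $\min_e \mathrm{csdd}(M\setminus e)$ (over elements $e$) and $\min_L \mathrm{csdd}(M/L)$ (over one-dimensional subspaces $L$). *)

(* Defs.v *)
From HB Require Import structures.
From mathcomp Require Import all_boot all_order all_algebra.
From mathcomp Require Import boolp.
From Stdlib Require Import Relation_Operators.

Set Implicit Arguments.
Unset Strict Implicit.
Unset Printing Implicit Defensive.

Import GRing.Theory.
Local Open Scope ring_scope.

(* The least element of a nonempty set of natural numbers, and 0 on the empty
   set.  Wherever [nat_min] is used below the set is nonempty, see
   [elimination_forest_exists], [tdI_star_attained], [deletion_exists] and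
   [line_exists]. *)
Definition nat_min_pred (P : nat -> Prop) : pred nat := fun k => `[< P k >].

Lemma nat_min_ex (P : nat -> Prop) :
  (exists k, P k) -> exists k, nat_min_pred P k.
Proof. by case=> k Pk; exists k; apply/asboolP. Qed.

Definition nat_min (P : nat -> Prop) : nat :=
  if pselect (exists k, P k) is left exP then ex_minn (nat_min_ex exP) else 0%N.

Lemma nat_min_in (P : nat -> Prop) k : P k -> P (nat_min P).
Proof.
move=> Pk; rewrite /nat_min; case: pselect => [exP|[]]; last by exists k.
by case: ex_minnP => j /asboolP.
Qed.

Lemma nat_min_le (P : nat -> Prop) k : P k -> (nat_min P <= k)%N.
Proof.
move=> Pk; rewrite /nat_min; case: pselect => [exP|[]]; last by exists k.
by case: ex_minnP => j _; apply; apply/asboolP.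
Qed.

Lemma eq_nat_min (P Q : nat -> Prop) :
  (forall k, P k <-> Q k) -> nat_min P = nat_min Q.
Proof.
by move=> eqPQ; congr nat_min; apply/funext=> k; apply/propext/eqPQ.
Qed.

Section TreeDepth.
Variable V : finType.
Implicit Types (p : {ffun V -> option V}) (e : rel V).

(* A rooted forest on V is encoded by its parent function; roots are sent to
   None. *)
Definition is_parent p : rel V := [rel x y | p x == Some y].

Definition ancestor p : rel V := [rel y x | connect (is_parent p) x y].

Definition rooted_forest p : bool :=
  [forall x, forall y, is_parent p x y ==> ~~ ancestor p x y].

Definition leaf p : pred V := [pred x | [forall y, ~~ is_parent p y x]].

(* The vertices of the path from x to the root of its tree are the ancestors
   of x, which include x itself. *)
Definition forest_height p : nat :=
  \max_(x | leaf p x) #|[set y | ancestor p y x]|.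

Definition elimination_forest e p : bool :=
  rooted_forest p &&
  [forall x, forall y, e x y ==> ancestor p x y || ancestor p y x].

Definition treedepth e : nat :=
  nat_min (fun k => exists2 p, elimination_forest e p & k = forest_height p).

Lemma elimination_forest_exists e : exists p, elimination_forest e p.
Proof.
pose s := enum V.
pose p : {ffun V -> option V} :=
  [ffun x => if index x s is i.+1 then Some (nth x s i) else None].
have sV x : x \in s by rewrite mem_enum.
have p_idx x y : is_parent p x y = (index x s == (index y s).+1).
  rewrite /is_parent /= ffunE; case Dx: (index x s) => [|i] //.
  have lt_i : (i < size s)%N.
    by rewrite ltnW // -Dx index_mem.
  rewrite eqSS; apply/eqP/eqP => [[<-]|->]; last by rewrite nth_index.
  by rewrite index_uniq ?enum_uniq.
have anc_le x y : ancestor p y x -> (index y s <= index x s)%N.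
  case/connectP=> q; elim: q x => [|z q IHq] x /=; first by move=> _ ->.
  rewrite p_idx => /andP[/eqP-> /IHq{}IHq /IHq]; exact: leqW.
have le_anc k x y : index x s = (index y s + k)%N -> ancestor p y x.
  elim: k x => [|k IHk] x Dx.
    rewrite addn0 in Dx.
    by rewrite /ancestor /= -(nth_index x (sV x)) Dx nth_index ?connect0.
  have lt_k : (index y s + k < size s)%N.
    by rewrite ltnW // -addnS -Dx index_mem.
  pose z := nth x s (index y s + k).
  have Dz : index z s = (index y s + k)%N by rewrite index_uniq ?enum_uniq.
  apply: (@connect_trans _ _ z); last exact: IHk.
  by apply: connect1; rewrite p_idx Dx Dz addnS.
exists p; apply/andP; split.
  apply/forallP=> x; apply/forallP=> y; apply/implyP; rewrite p_idx => /eqP Dx.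
  by apply/negP=> /anc_le; rewrite Dx ltnn.
apply/forallP=> x; apply/forallP=> y; apply/implyP=> _; apply/orP.
case/orP: (leq_total (index x s) (index y s)) => le_xy; [left | right].
  by apply: (le_anc (index y s - index x s)%N); rewrite subnKC.
by apply: (le_anc (index x s - index y s)%N); rewrite subnKC.
Qed.

End TreeDepth.

Section Matrices.
Variables (F : fieldType) (m n : nat).
Implicit Types A B : 'M[F]_(m, n).

Variant row_operation A : 'M[F]_(m, n) -> Prop :=
  | RowAdd (i j : 'I_m) (a : F) of i != j :
      row_operation A
        (\matrix_(k, l) if k == i then A i l + a * A j l else A k l)
  | RowScale (i : 'I_m) (a : F) of a != 0 :
      row_operation A (\matrix_(k, l) if k == i then a * A i l else A k l).

Definition row_equivalent : 'M[F]_(m, n) -> 'M[F]_(m, n) -> Prop :=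
  clos_refl_trans _ row_operation.

Definition incidence_graph A : rel ('I_m + 'I_n) := fun x y =>
  match x, y with
  | inl r, inr c | inr c, inl r => A r c != 0
  | _, _ => false
  end.

Definition tdI A : nat := treedepth (incidence_graph A).

Definition tdI_star A : nat :=
  nat_min (fun k => exists2 B, row_equivalent A B & k = tdI B).

Lemma tdI_star_attained A : exists2 B, row_equivalent A B & tdI_star A = tdI B.
Proof.
pose P k := exists2 B, row_equivalent A B & k = tdI B.
by apply: (@nat_min_in P (tdI A)); exists A => //; apply: rt_refl.
Qed.

End Matrices.

Section Quotient.
Variables (F : fieldType) (V : vectType F) (L : {vspace V}).

(* The quotient space V / L, realised as a complement of L; the quotient map
   is then the projection onto this complement along L.  The lemmas
   [quotv_eq0] and [quotv_surj] characterise it up to isomorphism. *)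
Definition quotV : vectType F := subvs_of (L^C)%VS.

Definition quotv (v : V) : quotV := Subvs (memv_pi (L^C)%VS L v).

Lemma quotv_is_linear : linear quotv.
Proof. by move=> a u v; apply: val_inj; rewrite /= linearP. Qed.

Lemma quotv_eq0 v : (quotv v == 0) = (v \in L).
Proof.
have capL : (L^C :&: L = 0)%VS by rewrite capvC capv_compl.
have capL' : (L :&: L^C = 0)%VS by rewrite capv_compl.
apply/eqP/idP => [/(congr1 val)/= v0 | Lv].
  have := @daddv_pi_add _ _ (L^C)%VS L v capL.
  rewrite addvC addv_complf memvf v0 add0r => <- //; exact: memv_pi.
apply: val_inj => /=.
have := @daddv_pi_add _ _ (L^C)%VS L v capL.
rewrite addvC addv_complf memvf => /(_ isT).
by rewrite (daddv_pi_id capL' Lv) => /(canRL (addrK _)); rewrite subrr.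
Qed.

Lemma quotv_surj (w : quotV) : exists v, quotv v = w.
Proof.
exists (val w); apply: val_inj => /=.
by rewrite daddv_pi_id ?subvsP // capvC capv_compl.
Qed.

Lemma dim_quotV : \dim {: quotV} = (\dim {: V} - \dim L)%N.
Proof. by rewrite [LHS]dimvf -dimv_compl. Qed.

End Quotient.

(* The matroid has ground set [ground]; the values of [vec] outside [ground]
   are irrelevant. *)
Record rmatroid (F : fieldType) (E : finType) := RMatroid {
  ambient : vectType F;
  ground : {set E};
  vec : E -> ambient
}.

Section RepresentedMatroids.
Variables (F : fieldType) (E : finType).
Implicit Types (M : rmatroid F E) (X C : {set E}) (e : E).

(* Distinct elements represented by equal vectors are
   dependent: [free] applies to the family, not to the set, of vectors. *)
Definition indep M X : bool :=
  (X \subset ground M) && free [seq vec M e | e <- enum X].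

Definition circuit M C : bool :=
  minset [pred X : {set E} | (X \subset ground M) && ~~ indep M X] C.

Definition mconnected M : bool :=
  [forall x in ground M, forall y in ground M,
    (x != y) ==> [exists C : {set E}, [&& circuit M C, x \in C & y \in C]]].

Definition mrank M : nat := \dim <<[seq vec M e | e <- enum (ground M)]>>%VS.

Definition mdelete M e : rmatroid F E := RMatroid (ground M :\ e) (vec M).

Definition mrestrict M X : rmatroid F E := RMatroid (ground M :&: X) (vec M).

Definition mquotient M (L : {vspace ambient M}) : rmatroid F E :=
  RMatroid (ground M) (fun e => quotv L (vec M e)).

Definition mcomponent M C : bool :=
  maxset [pred X : {set E} | (X \subset ground M) && mconnected (mrestrict M X)] C.

Definition csdd_step (f : rmatroid F E -> nat) M : nat :=
  if mrank M == 0%N then 0%N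
  else if #|ground M| == 1%N then 1%N
  else if ~~ mconnected M then \max_(C | mcomponent M C) f (mrestrict M C)
  else (minn
    (nat_min (fun k => exists2 e, e \in ground M & k = f (mdelete M e)))
    (nat_min (fun k => exists2 L : {vspace ambient M},
                         \dim L = 1%N & k = f (mquotient L)))).+1.

(* Each recursive call decreases [csdd_measure], so that the fuel suffices for
   [csdd] to satisfy its defining recursion: see [csddE]. *)
Definition csdd_measure M : nat := (#|ground M| + \dim {: ambient M})%N.

Fixpoint csdd_rec (k : nat) M : nat :=
  if k is k'.+1 then csdd_step (csdd_rec k') M else 0%N.

Definition csdd M : nat := csdd_rec (csdd_measure M) M.

Lemma rank_le_dim M : (mrank M <= \dim {: ambient M})%N.
Proof. exact: dimvS (subvf _). Qed.

Lemma deletion_exists M : mrank M != 0%N -> exists e, e \in ground M.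
Proof.
move=> rkM; apply/set0Pn; apply: contra rkM => /eqP S0.
by rewrite /mrank S0 enum_set0 span_nil dimv0.
Qed.

Lemma line_exists M :
  mrank M != 0%N -> exists L : {vspace ambient M}, \dim L = 1%N.
Proof.
rewrite dimv_eq0 -vpick0 => nz.
exists <[vpick <<[seq vec M e | e <- enum (ground M)]>>%VS]>%VS.
by rewrite dim_vline nz.
Qed.

Lemma eq_csdd_step (f g : rmatroid F E -> nat) M :
    (forall N, (csdd_measure N < csdd_measure M)%N -> f N = g N) ->
  csdd_step f M = csdd_step g M.
Proof.
move=> eqfg; rewrite /csdd_step; case: eqP => // /eqP rkM; case: ifP => // _.
case: ifP => [nconn | _].
  apply: eq_bigr => C /maxsetp/andP[sCS connC]; apply: eqfg.
  rewrite /csdd_measure /= ltn_add2r proper_card // (setIidPr sCS) properEneq sCS.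
  rewrite andbT; apply: contraNneq nconn => DC; rewrite {}DC in connC.
  by move: connC; clear; case: M => V S v; rewrite /mrestrict /= setIid.
congr (minn _ _).+1; apply: eq_nat_min => k; split.
- move=> [e Se ->]; exists e => //; apply: eqfg.
  by rewrite /csdd_measure /= ltn_add2r [ltnRHS](cardsD1 e) Se.
- move=> [e Se ->]; exists e => //; apply/esym/eqfg.
  by rewrite /csdd_measure /= ltn_add2r [ltnRHS](cardsD1 e) Se.
- move=> [L dL ->]; exists L => //; apply: eqfg.
  rewrite /csdd_measure /= ltn_add2l dim_quotV dL subn1 prednK //.
  by apply: leq_trans (rank_le_dim M); rewrite lt0n.
- move=> [L dL ->]; exists L => //; apply/esym/eqfg.
  rewrite /csdd_measure /= ltn_add2l dim_quotV dL subn1 prednK //.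
  by apply: leq_trans (rank_le_dim M); rewrite lt0n.
Qed.

Lemma csdd_rec_enough k M : (csdd_measure M <= k)%N -> csdd_rec k M = csdd M.
Proof.
have rk0 N : (csdd_measure N <= 0)%N -> mrank N = 0%N.
  rewrite leqn0 addn_eq0 => /andP[_ /eqP d0].
  by apply/eqP; rewrite -leqn0 -d0 rank_le_dim.
suff rec_eq j : (csdd_measure M <= j)%N -> (csdd_measure M <= k)%N ->
    csdd_rec k M = csdd_rec j M by exact: rec_eq.
elim: k j M => [|k IHk] [|j] M le_j le_k //=; try by rewrite /csdd_step rk0.
apply: eq_csdd_step => N ltN.
by apply: IHk; rewrite -ltnS; apply: leq_trans ltN _.
Qed.

Lemma csddE M : csdd M = csdd_step csdd M.
Proof.
rewrite -(@csdd_rec_enough (csdd_measure M).+1) //=.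
by apply: eq_csdd_step => N /ltnW; apply: csdd_rec_enough.
Qed.

End RepresentedMatroids.

Definition column_matroid (F : fieldType) (m n : nat) (A : 'M[F]_(m, n)) :
    rmatroid F 'I_n :=
  @RMatroid F 'I_n 'cV[F]_m [set: 'I_n] (fun j => col j A).

(* Main.v *)
From HB Require Import structures.
Require Import Defs.
From mathcomp Require Import all_boot all_order all_algebra.
From mathcomp Require Import boolp.
From Stdlib Require Import Relation_Operators.

(* Two matrices are row equivalent iff their columns satisfy the same linear
   relations, so everything is phrased with "the rows R of B represent M": on
   the ground set of M, the columns of B restricted to R satisfy exactly the
   linear relations of the vectors of M.  Removing a column of B as the root of
   an elimination forest deletes an element of M, removing a row contracts a
   line, and a disconnected incidence graph splits M.  Hence an elimination
   forest of a representing matrix bounds the depth of M.  Conversely, following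
   the recursion for the depth, a matrix with mrank M rows (or any larger
   number) representing M is assembled block by block over the components, by
   adding the deleted element as a new column, or by adding as a new row a
   functional that does not vanish on the contracted line. *)

Set Implicit Arguments.
Unset Strict Implicit.
Unset Printing Implicit Defensive.

Import GRing.Theory.
Local Open Scope ring_scope.

(** * Recursive description of tree-depth *)

Section TreeDepthRecursion.
Variable V : finType.
Implicit Types (e : rel V) (p : {ffun V -> option V}) (X Y : {set V}).

(** The [+ 1] comes from zero columns and zero rows: they are still vertices, so depth 0 already
    costs height 1. The lower bound is therefore the strict inequality [csdd M < k], which forces
    the ground set to be nonempty. Two obstacles shape the argument. An equivalent matrix has
    exactly m rows, however small the rank, so the construction has to succeed on every row set with
    at least [mrank M] elements; this freedom is also what lets rows be distributed over the
    components and lets a contraction consume one row. Secondly, connectivity of the graph and of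
    the matroid do not match: a connected graph may carry a disconnected matroid, and a connected
    matroid may be represented with extra isolated rows. The lower bound therefore passes to
    connected restrictions, where any separation of the graph has all elements on one side. *)

Definition nonadjacent e X Y :=
  forall x y, x \in X -> y \in Y -> ~~ e x y && ~~ e y x.

(** Derivations replace forests, so that bounds are proved by induction and forests are built by
    constructors. [TdUnion] accepts any nonadjacent pieces, connected or not, so no graph component
    has to be computed. *)
Inductive td_le e : nat -> {set V} -> Prop :=
| TdEmpty k : td_le e k set0
| TdRoot k X v of v \in X & td_le e k (X :\ v) : td_le e k.+1 X
| TdUnion k X Y of [disjoint X & Y] & nonadjacent e X Y &
    td_le e k X & td_le e k Y : td_le e k (X :|: Y).

Lemma td_le_height0 e X : td_le e 0 X -> X = set0.
Proof.
move Dk: 0%N => k td; elim: td Dk => // {}k {}X Y _ _ _ IHX _ IHY Dk.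
by rewrite IHX // IHY // setU0.
Qed.

Lemma td_le_mono e k l X : (k <= l)%N -> td_le e k X -> td_le e l X.
Proof.
move=> le_kl td; elim: td l le_kl => {k X}.
- by move=> *; apply: TdEmpty.
- by move=> k X v Xv _ IH [|l] // le_kl; apply: (TdRoot Xv); apply: IH.
- by move=> k X Y dXY nXY _ IHX _ IHY l le_kl; apply: TdUnion; auto.
Qed.

Lemma td_le_sub e e' k X :
    {in X &, forall x y, e' x y -> e x y} -> td_le e k X -> td_le e' k X.
Proof.
move=> sub td; elim: td sub => {k X}.
- by move=> *; apply: TdEmpty.
- move=> k X v Xv _ IH sub; apply: (TdRoot Xv); apply: IH.
  by move=> x y /setD1P[_ Xx] /setD1P[_ Xy]; apply: sub.
- move=> k X Y dXY nXY _ IHX _ IHY sub; apply: TdUnion => //.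
  + move=> x y Xx Yy; have /andP[nxy nyx] := nXY x y Xx Yy.
    have XYx : x \in X :|: Y by rewrite inE Xx.
    have XYy : y \in X :|: Y by rewrite inE Yy orbT.
    by rewrite (contra (sub _ _ XYx XYy)) // (contra (sub _ _ XYy XYx)).
  + by apply: IHX => x y Xx Xy; apply: sub; rewrite inE ?Xx ?Xy.
  + by apply: IHY => x y Xx Xy; apply: sub; rewrite inE ?Xx ?Xy orbT.
Qed.

Lemma td_le_bigcup e k (I : finType) (s : seq I) (f : I -> {set V}) :
    uniq s ->
    {in s &, forall i j, i != j -> [disjoint f i & f j]} ->
    {in s &, forall i j, i != j -> nonadjacent e (f i) (f j)} ->
    {in s, forall i, td_le e k (f i)} ->
  td_le e k (\bigcup_(i <- s) f i).
Proof.
elim: s => [|i s IHs] /=; first by move=> *; rewrite big_nil; apply: TdEmpty.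
case/andP=> s'i Us dis nadj tds; rewrite big_cons.
have neq j : j \in s -> i != j by move=> sj; apply: contraNneq s'i => ->.
have si : i \in i :: s by rewrite inE eqxx.
have ss j : j \in s -> j \in i :: s by rewrite inE => ->; rewrite orbT.
apply: TdUnion.
- rewrite bigcup_seq; apply: bigcup_disjoint => j sj.
  by apply: dis => //; [apply: ss | apply: neq].
- move=> x y fx; rewrite bigcup_seq => /bigcupP[j sj fy].
  by apply: (nadj i j) => //; [apply: ss | apply: neq].
- exact: tds.
- by apply: IHs => // [j l sj sl|j l sj sl|j sj];
    [apply: dis | apply: nadj | apply: tds]; apply: ss.
Qed.

Lemma td_le_edgeless e X : {in X &, forall x y, ~~ e x y} -> td_le e 1 X.
Proof.
move=> noE; have -> : X = \bigcup_(x <- enum X) [set x].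
  apply/setP=> y; rewrite bigcup_seq; apply/idP/bigcupP => [Xy|[x]].
    by exists y; rewrite ?mem_enum ?set11.
  by rewrite mem_enum => Xx /set1P->.
apply: td_le_bigcup; first exact: enum_uniq.
- by move=> x y _ _ xy; rewrite disjoints1 inE.
- move=> x y; rewrite !mem_enum => Xx Xy _ a b /set1P-> /set1P->.
  by rewrite !noE.
- move=> x _; apply: (@TdRoot _ _ _ x); rewrite ?set11 // setDv.
  exact: TdEmpty.
Qed.

(** * Translation between elimination forests and [td_le] *)

Definition ancestors p x := [set y | ancestor p y x].

Lemma mem_ancestors p x y : (y \in ancestors p x) = connect (is_parent p) x y.
Proof. by rewrite inE. Qed.

Lemma ancestors_sub p x y : y \in ancestors p x -> ancestors p y \subset ancestors p x.
Proof.
rewrite mem_ancestors => xy; apply/subsetP=> z.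
by rewrite !mem_ancestors; apply: connect_trans.
Qed.

(** A vertex has at most one parent, so of two upward paths from x one is a prefix of the other. *)
Lemma ancestor_chain p x y z :
    connect (is_parent p) x y -> connect (is_parent p) x z ->
  connect (is_parent p) y z || connect (is_parent p) z y.
Proof.
case/connectP=> q; elim: q x => [|a q IHq] x /=; first by move=> _ -> ->.
case/andP=> xa path_q Dy xz.
case/connectP: (xz) => [[|b r]] /=.
  move=> _ ->; apply/orP; right; apply: (connect_trans (connect1 xa)).
  by apply/connectP; exists q.
case/andP=> xb path_r Dz.
have Dab : b = a by move: xa xb; rewrite /is_parent /= => /eqP-> /eqP[].
apply: (IHq a) => //; apply/connectP; exists r => //; by rewrite -Dab.
Qed.

Section Forest.
Variable p : {ffun V -> option V}.
Hypothesis forest_p : rooted_forest p.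

Lemma ancestor_anti x y :
  connect (is_parent p) x y -> connect (is_parent p) y x -> x = y.
Proof.
case/connectP=> [[|z q]] /=; first by move=> _ ->.
case/andP=> xz path_q Dy yx; have zy : connect (is_parent p) z y.
  by apply/connectP; exists q.
move/forallP/(_ x)/forallP/(_ z)/implyP/(_ xz): forest_p.
by rewrite /ancestor /= (connect_trans zy yx).
Qed.

Lemma card_ancestors_lt x y : y \in ancestors p x -> y != x ->
  ancestors p y \proper ancestors p x.
Proof.
move=> xy yx; rewrite properE ancestors_sub //=; apply/subsetPn; exists x.
  by rewrite mem_ancestors.
rewrite mem_ancestors; apply: contra yx => yx; apply/eqP/ancestor_anti => //.
by rewrite -mem_ancestors.
Qed.

(** The height is a maximum over leaves only. Among the descendants of x, one with the most
    ancestors is a leaf, because a child would have strictly more. *)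
Lemma card_ancestors_le x : (#|ancestors p x| <= forest_height p)%N.
Proof.
pose D := [pred y | x \in ancestors p y].
have Dx : D x by rewrite /= mem_ancestors.
case: (@arg_maxnP _ x D (fun y => #|ancestors p y|) Dx) => y Dy max_y.
apply: (@leq_trans #|ancestors p y|); first exact/subset_leq_card/ancestors_sub.
rewrite /forest_height.
apply: (bigmax_sup y) => //; apply/forallP=> z; apply/negP=> zy.
have yz : y \in ancestors p z by rewrite mem_ancestors connect1.
have y'z : y != z.
  apply: contraTneq zy => ->; apply/negP=> zz.
  move/forallP/(_ z)/forallP/(_ z)/implyP/(_ zz): forest_p.
  by rewrite /ancestor /= connect0.
have /proper_card := card_ancestors_lt yz y'z; rewrite ltnNge => /negP; apply.
by apply: max_y; rewrite /= (subsetP (ancestors_sub yz)).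
Qed.

Lemma elimination_forest_td_le e : elimination_forest e p ->
  td_le e (forest_height p) [set: V].
Proof.
case/andP=> _ /forallP elim_p.
have cover x y : e x y -> (x \in ancestors p y) || (y \in ancestors p x).
  by move=> exy; rewrite !inE; move/forallP/(_ y)/implyP: (elim_p x); apply.
(* Removing vertices destroys the forest structure on what is left, so the forest stays fixed and
   only the ancestors inside X are counted. *)
suff main n k X : (#|X| <= n)%N ->
    {in X, forall x, #|ancestors p x :&: X| <= k}%N -> td_le e k X.
  apply: (main _ _ _ (leqnn _)) => x _; rewrite setIT; exact: card_ancestors_le.
elim: n k X => [|n IHn] k X leXn le_k.
  by move: leXn; rewrite leqn0 cards_eq0 => /eqP->; apply: TdEmpty.
have [->|/set0Pn[x0 Xx0]] := eqVneq X set0; first exact: TdEmpty.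
(* Minimality makes t topmost in X. Its descendants D in X form one piece: removing t lowers the
   count there by one, while the rest of X is treated by induction on its size. *)
have [t Xt min_t] := @arg_minnP _ x0 (mem X) (fun x => #|ancestors p x :&: X|) Xx0.
have {}Xt : t \in X by [].
have root_t y : y \in X -> y \in ancestors p t -> y = t.
  move=> Xy ty; apply/eqP; apply: contraLR (min_t y Xy) => yt; rewrite -ltnNge.
  apply: proper_card; rewrite properE; apply/andP; split.
    by rewrite setSI // ancestors_sub.
  apply/subsetPn; exists t; first by rewrite inE Xt mem_ancestors connect0.
  rewrite inE Xt andbT; apply: contra yt => yt; apply/eqP.
  by apply: ancestor_anti; rewrite -mem_ancestors.
pose D := X :&: [set x | t \in ancestors p x].
have Dt : t \in D by rewrite inE Xt inE mem_ancestors /=.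
have ->: X = D :|: (X :\: D) by rewrite -{1}(setID X D) (setIidPr (subsetIl _ _)).
have k_gt0 : (0 < k)%N.
  apply: leq_trans (le_k t Xt); rewrite card_gt0; apply/set0Pn; exists t.
  by rewrite inE Xt mem_ancestors connect0.
apply: TdUnion.
- by rewrite -setI_eq0 setIDA setDIl setDv set0I.
(* A vertex of X above some x in D is comparable with t by [ancestor_chain]; it cannot lie strictly
   above t, so it belongs to D. *)
- have nadj x y : x \in D -> y \in X -> (x \in ancestors p y) || (y \in ancestors p x) ->
      y \in D.
    rewrite inE inE => /andP[Xx xt] Xy /orP[yx|xy].
      by rewrite inE Xy inE (subsetP (ancestors_sub yx)).
    move: (xt) (xy); rewrite !mem_ancestors => xt' xy'.
    have /orP[ty|yt] := ancestor_chain xt' xy'; last by rewrite inE Xy inE mem_ancestors.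
    by rewrite (root_t y) // mem_ancestors.
  move=> x y Dx /setDP[Xy D'y]; apply/andP; split; apply: contra D'y => /cover xy.
    exact: nadj xy.
  by apply: nadj Dx Xy _; rewrite orbC.
- case: k k_gt0 le_k => // k _ le_k; apply: (TdRoot Dt); apply: IHn.
    rewrite -ltnS; apply: leq_trans leXn; apply: proper_card.
    apply: (@proper_sub_trans _ _ D); last exact: subsetIl.
    by rewrite properD1.
  move=> x /setD1P[xt /setIP[Xx]]; rewrite inE => tx; rewrite -ltnS.
  apply: leq_trans (le_k x Xx); apply: proper_card; rewrite properE.
  apply/andP; split.
    by rewrite setIS // (subset_trans (subsetDl _ _)) // subsetIl.
  apply/subsetPn; exists t; last by rewrite in_setI setD11 andbF.
  by rewrite in_setI tx.
- apply: IHn.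
    rewrite -ltnS; apply: leq_trans leXn; apply: proper_card; rewrite properE subsetDl.
    by apply/subsetPn; exists t; rewrite // inE Dt.
  move=> x /setDP[Xx _]; apply: leq_trans (le_k x Xx).
  by rewrite subset_leq_card // setIS // subsetDl.
Qed.

End Forest.

Lemma td_le_elimination_forest e k : td_le e k [set: V] ->
  exists2 p, elimination_forest e p & (forest_height p <= k)%N.
Proof.
(* Parent pairs stay inside X, so vertices outside X are isolated roots and forests on disjoint sets
   can be glued by cases. *)
pose good k X p := [/\ rooted_forest p,
   forall x y, is_parent p x y -> (x \in X) && (y \in X),
   {in X &, forall x y, e x y -> connect (is_parent p) x y || connect (is_parent p) y x} &
   {in X, forall x, #|ancestors p x| <= k}%N].
suff main X : td_le e k X -> exists p, good k X p.
  case/main=> p [forest_p _ elim_p le_k]; exists p.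
    rewrite /elimination_forest forest_p; apply/forallP=> x; apply/forallP=> y.
    by apply/implyP=> /elim_p; rewrite !in_setT orbC; apply.
  by apply/bigmax_leqP=> x _; apply: le_k.
have parentE (p : {ffun V -> option V}) x y : is_parent p x y = (p x == Some y) by [].
elim=> {k X}.
- move=> k; exists [ffun=> None]; split.
  + by apply/forallP=> x; apply/forallP=> y; rewrite parentE ffunE.
  + by move=> x y; rewrite parentE ffunE.
  + by move=> x y; rewrite inE.
  + by move=> x; rewrite inE.
- move=> k X v Xv _ [p [forest_p closed elim_p le_k]].
  (* The old roots in [X :\ v] are hung below v, which becomes the only root in X. *)
  pose p' : {ffun V -> option V} :=
    [ffun x => if x \in X :\ v then Some (odflt v (p x)) else None].
  have p'P x y : is_parent p' x y -> x \in X :\ v /\ (is_parent p x y \/ y = v).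
    rewrite parentE ffunE; case: ifP => // X'x; rewrite parentE.
    by case: (p x) => [z|] /= /eqP[<-]; split; auto.
  have pp' x y : is_parent p x y -> is_parent p' x y.
    move=> xy; have /andP[X'x _] := closed _ _ xy.
    by move: xy; rewrite !parentE ffunE X'x => /eqP->.
  have cpp' x y : connect (is_parent p) x y -> connect (is_parent p') x y.
    by move=> xy; apply: connect_sub xy => a b ab; apply: connect1; apply: pp'.
  have v_root y : connect (is_parent p') v y -> y = v.
    case/connectP=> [[|z q]] /=; first by move=> _ ->.
    by case/andP=> /p'P[]; rewrite setD11.
  have cp'p x y : connect (is_parent p') x y -> connect (is_parent p) x y \/ y = v.
    case/connectP=> q; elim: q x => [|z q IHq] x /=; first by move=> _ ->; left.
    case/andP=> /p'P[_ [xz|->]] path_q Dy; last first.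
      by right; apply: v_root; apply/connectP; exists q.
    case: (IHq z path_q Dy) => [zy|]; last by right.
    by left; apply: connect_trans (connect1 xz) zy.
  have to_v x : x \in X :\ v -> connect (is_parent p') x v.
    have [n] := ubnP #|ancestors p x|; elim: n x => // n IHn x.
    rewrite ltnS => le_n X'x; case Dpx: (p x) => [z|]; last first.
      by apply: connect1; rewrite parentE ffunE X'x Dpx.
    have xz : is_parent p x z by rewrite parentE Dpx.
    have /andP[_ X'z] := closed _ _ xz.
    apply: connect_trans (connect1 (pp' _ _ xz)) (IHn z _ X'z).
    apply: leq_trans le_n; apply/proper_card/card_ancestors_lt => //.
      by rewrite mem_ancestors connect1.
    apply: contraTneq xz => ->; apply/negP=> xx.
    move/forallP/(_ x)/forallP/(_ x)/implyP/(_ xx): forest_p.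
    by rewrite /ancestor /= connect0.
  exists p'; split.
  + apply/forallP=> x; apply/forallP=> y; apply/implyP=> /p'P[X'x []].
      move=> xy; apply/negP; rewrite /ancestor /= => /cp'p[yx|Dx].
        move/forallP/(_ x)/forallP/(_ y)/implyP/(_ xy): forest_p.
        by rewrite /ancestor /= yx.
      by rewrite Dx setD11 in X'x.
    move=> ->; apply/negP=> /v_root Dx; by rewrite Dx setD11 in X'x.
  + move=> x y xy; have [/setD1P[_ ->] [/closed|->]] := p'P _ _ xy; last by rewrite Xv.
    by case/andP=> _ /setD1P[].
  + move=> x y Xx Xy exy.
    have [->|xv] := eqVneq x v.
      have [->|yv] := eqVneq y v; first by rewrite connect0.
      by rewrite (to_v y) ?orbT // !inE yv.
    have [->|yv] := eqVneq y v; first by rewrite (to_v x) // !inE xv.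
    have X'x : x \in X :\ v by rewrite in_setD1 xv.
    have X'y : y \in X :\ v by rewrite in_setD1 yv.
    by case/orP: (elim_p x y X'x X'y exy) => /cpp'->; rewrite ?orbT.
  + move=> x Xx; have [->|xv] := eqVneq x v.
      rewrite (@leq_trans 1) // -(cards1 v) subset_leq_card //.
      by apply/subsetP=> y; rewrite mem_ancestors => /v_root->; rewrite set11.
    apply: (@leq_trans #|v |: ancestors p x|).
      apply/subset_leq_card/subsetP=> y; rewrite mem_ancestors !inE.
      by case/cp'p => [|->]; rewrite ?eqxx // /ancestor /= => ->; rewrite orbT.
    by rewrite cardsU1 -add1n leq_add ?leq_b1 // le_k // !inE xv.
- move=> k X Y dXY nXY _ [p1 [f1 c1 el1 le1]] _ [p2 [f2 c2 el2 le2]].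
  pose p : {ffun V -> option V} := [ffun x => if x \in X then p1 x else p2 x].
  have YX x : x \in Y -> x \in X = false.
    exact: disjointFl.
  have pX x y : x \in X -> is_parent p x y = is_parent p1 x y.
    by move=> Xx; rewrite !parentE ffunE Xx.
  have pY x y : x \in Y -> is_parent p x y = is_parent p2 x y.
    by move=> /YX Yx; rewrite !parentE ffunE Yx.
  have eq_con Z q x y : (forall x y, is_parent q x y -> (x \in Z) && (y \in Z)) ->
      (forall x y, x \in Z -> is_parent p x y = is_parent q x y) ->
      x \in Z -> connect (is_parent p) x y = connect (is_parent q) x y.
    move=> cl pq Zx; apply/idP/idP.
      case/connectP=> r; elim: r x Zx => [|z r IHr] x Zx /=; first by move=> _ ->.
      rewrite pq // => /andP[xz]; have /andP[_ Zz] := cl _ _ xz.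
      by move=> path_r Dy; apply: connect_trans (connect1 xz) (IHr _ Zz path_r Dy).
    apply: connect_sub => a b ab; apply: connect1.
    by rewrite pq //; have /andP[] := cl _ _ ab.
  have cX x y : x \in X -> connect (is_parent p) x y = connect (is_parent p1) x y.
    exact: eq_con.
  have cY x y : x \in Y -> connect (is_parent p) x y = connect (is_parent p2) x y.
    exact: eq_con.
  have p_in x y : is_parent p x y -> (x \in X) && (y \in X) \/ (x \in Y) && (y \in Y).
    have [Xx|X'x] := boolP (x \in X); first by rewrite pX // => /c1; rewrite Xx; left.
    rewrite parentE ffunE (negPf X'x) => /c2; by right.
  exists p; split.
  + apply/forallP=> x; apply/forallP=> y; apply/implyP=> xy; rewrite /ancestor /=.
    case: (p_in _ _ xy) => /andP[Zx Zy].
      rewrite cX //; rewrite pX // in xy.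
      by move/forallP/(_ x)/forallP/(_ y)/implyP/(_ xy): f1.
    rewrite cY //; rewrite pY // in xy.
    by move/forallP/(_ x)/forallP/(_ y)/implyP/(_ xy): f2.
  + by move=> x y /p_in[] /andP[Zx Zy]; rewrite !inE Zx Zy ?orbT.
  + move=> x y /setUP[Xx|Yx] /setUP[Xy|Yy] exy.
    * by rewrite !cX // el1.
    * by have := nXY x y Xx Yy; rewrite exy.
    * by have := nXY y x Xy Yx; rewrite exy andbF.
    * by rewrite !cY // el2.
  + move=> x /setUP[Xx|Yx].
      rewrite (_ : ancestors p x = ancestors p1 x) ?le1 //.
      by apply/setP=> y; rewrite !mem_ancestors cX.
    rewrite (_ : ancestors p x = ancestors p2 x) ?le2 //.
    by apply/setP=> y; rewrite !mem_ancestors cY.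
Qed.

Lemma treedepth_leE e k : (treedepth e <= k)%N <-> td_le e k [set: V].
Proof.
split=> [le_k|/td_le_elimination_forest[p elim_p le_p]].
  apply: td_le_mono le_k _; have [p0 elim_p0] := elimination_forest_exists e.
  pose P k := exists2 p, elimination_forest e p & k = forest_height p.
  have [|p elim_p Dp] := @nat_min_in P (forest_height p0); first by exists p0.
  rewrite /treedepth Dp; apply: elimination_forest_td_le => //.
  by case/andP: elim_p.
by apply: leq_trans le_p; apply: nat_min_le; exists p.
Qed.

End TreeDepthRecursion.

(** * Circuits and components of a represented matroid *)

Section Families.
Variables (F : fieldType) (V : vectType F) (E : finType).
Implicit Types (v : E -> V) (X : {set E}).

Lemma mem_span_family v X u :
  u \in <<[seq v e | e <- enum X]>>%VS <->
  exists c : E -> F, u = \sum_(e in X) c e *: v e.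
Proof.
rewrite span_def big_map big_enum; split.
  case/memv_sumP=> vs vsP ->.
  have /choice[c cP] (e : E) : exists a, e \in X -> vs e = a *: v e.
    have [Xe|] := boolP (e \in X); last by exists 0.
    by have /vlineP[a ->] := vsP e Xe; exists a.
  by exists c; apply: eq_bigr.
by case=> c ->; apply: memv_sumr => e _; rewrite memvZ ?memv_line.
Qed.

Lemma free_family v X :
  free [seq v e | e <- enum X] <->
  forall c : E -> F, \sum_(e in X) c e *: v e = 0 -> {in X, forall e, c e = 0}.
Proof.
have nthE (i : 'I_#|X|) : [seq v e | e <- enum X]`_i = v (enum_val i).
  by rewrite (nth_map (enum_default i)) // -cardE.
split=> [/(@freeP _ _ _ (map_tuple v (enum_tuple X))) frX c c0 e Xe | frX].
  rewrite -(enum_rankK_in Xe Xe); apply: (frX (fun i => c (enum_val i))).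
  rewrite big_enum_val in c0; rewrite -[RHS]c0; apply: eq_bigr => i _.
  by rewrite -nthE.
apply/(@freeP _ _ _ (map_tuple v (enum_tuple X))) => k k0 i.
pose c e := k (enum_rank_in (enum_valP i) e).
have cE j : c (enum_val j) = k j by rewrite /c enum_valK_in.
rewrite -cE; apply: frX (enum_valP i); rewrite big_enum_val -[RHS]k0.
by apply: eq_bigr => j _; rewrite cE -nthE.
Qed.

End Families.

Section LinearRelations.
Variables (F : fieldType) (E : finType).
Implicit Types (M : rmatroid F E) (X Y C D : {set E}) (c d : E -> F).

(** Coefficients live on all of [E] and those outside the ground set are ignored, so one and the
    same c can be tested against M, its restrictions, its quotients and a matrix. *)
Definition relation M c := \sum_(e in ground M) c e *: vec M e = 0.

Definition support M c := [set e in ground M | c e != 0].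

Lemma support_sub M c : support M c \subset ground M.
Proof. by apply/subsetP=> e; rewrite inE => /andP[]. Qed.

Lemma relationB M a c d :
  relation M c -> relation M d -> relation M (fun e => c e - a * d e).
Proof.
rewrite /relation => c0 d0.
rewrite (eq_bigr (fun e => c e *: vec M e - a *: (d e *: vec M e))) => [|e _].
  by rewrite sumrB -scaler_sumr c0 d0 scaler0 subr0.
by rewrite scalerBl scalerA.
Qed.

Lemma relation_restrict M X c :
  relation (mrestrict M X) c <-> relation M (fun e => if e \in X then c e else 0).
Proof.
rewrite /relation /=; suff -> : \sum_(e in ground M :&: X) c e *: vec M e =
  \sum_(e in ground M) (if e \in X then c e else 0) *: vec M e by [].
rewrite [RHS](big_setID X) /= [X in _ + X]big1 ?addr0.
  by apply: eq_bigr => e /setIP[_ ->].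
by move=> e /setDP[_ /negPf->]; rewrite scale0r.
Qed.

Lemma dependent_relation M X : X \subset ground M ->
  ~~ indep M X <-> exists c, [/\ relation M c, support M c \subset X & support M c != set0].
Proof.
move=> sX; rewrite /indep sX /=; split=> [/negP nfr|[c [c0 scX /set0Pn[e sce]]]].
  apply: contrapT => nex; apply: nfr; apply/free_family => c c0 e Xe.
  apply: contrapT => /eqP ce; apply: nex.
  exists (fun e => if e \in X then c e else 0); split.
  - by apply/relation_restrict; rewrite /relation /= (setIidPr sX).
  - by apply/subsetP=> y; rewrite inE; case: (y \in X); rewrite ?eqxx ?andbF.
  - by apply/set0Pn; exists e; rewrite inE Xe (subsetP sX).
apply/negP=> /free_family/(_ c) frX.
have : e \in X by apply: (subsetP scX).
have := sce; rewrite inE => /andP[_ /eqP ce] Xe; apply: ce; apply: frX Xe.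
rewrite -[RHS]c0 [RHS](big_setID X) /= (setIidPr sX) [X in _ + X]big1 ?addr0 //.
move=> y /setDP[Sy X'y]; suff /eqP-> : c y == 0 by rewrite scale0r.
by apply: contraNT X'y => cy; apply: (subsetP scX); rewrite inE Sy.
Qed.

Lemma circuit_sub M C : circuit M C -> C \subset ground M.
Proof. by case/minsetP=> /andP[]. Qed.

Lemma circuit_min M C c : circuit M C -> relation M c ->
  support M c \subset C -> support M c != set0 -> support M c = C.
Proof.
case/minsetP=> /andP[sC _] minC c0 scC nz; apply: minC => //=.
rewrite support_sub; apply/dependent_relation; first exact: support_sub.
by exists c.
Qed.

Lemma circuit_relation M C : circuit M C ->
  exists2 c, relation M c & support M c = C.
Proof.
move=> circC; have /minsetP[/andP[sC /(dependent_relation sC)[c [c0 scC nz]]] _] := circC.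
by exists c => //; apply: circuit_min.
Qed.

Lemma circuit_min_sub M C D : circuit M C -> circuit M D -> D \subset C -> D = C.
Proof. by case/minsetP=> _ minC /minsetP[/= dD _]; apply: minC. Qed.

Lemma circuit_neq0 M C : circuit M C -> exists x, x \in C.
Proof.
case/minsetP=> /andP[sC /(dependent_relation sC)[c [_ scC /set0Pn[x cx]]]] _.
by exists x; apply: (subsetP scC).
Qed.

(** If a circuit inside the support misses x, subtracting a multiple of its relation clears one of
    its coordinates: the support shrinks, the coefficient at x is unchanged, and induction
    applies. *)
Lemma circuit_in_support M c x : relation M c -> x \in support M c ->
  exists C, [/\ circuit M C, x \in C & C \subset support M c].
Proof.
have [n] := ubnP #|support M c|; elim: n c => // n IHn c.
rewrite ltnS => le_n c0 cx.
have depc : [pred X : {set E} | (X \subset ground M) && ~~ indep M X] (support M c).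
  rewrite /= support_sub; apply/dependent_relation; first exact: support_sub.
  by exists c; split=> //; apply/set0Pn; exists x.
have [C circC sCc] := minset_exists depc.
have [Cx|C'x] := boolP (x \in C); first by exists C.
have [d d0 Dd] := circuit_relation circC; have [y Cy] := circuit_neq0 circC.
have Sx := subsetP (support_sub M c) x cx.
have Sy := subsetP (circuit_sub circC) y Cy.
have dx : d x = 0 by apply/eqP; move: C'x; rewrite -Dd inE Sx negbK.
have dy : d y != 0 by move: Cy; rewrite -Dd inE Sy.
pose c' e := c e - (c y / d y) * d e.
have c'0 : relation M c' by apply: relationB.
have sc'c : support M c' \subset support M c :\ y.
  apply/subsetP=> e; rewrite in_setD1 !inE => /andP[Se].
  have [->|_] := eqVneq e y; first by rewrite /c' divfK // subrr eqxx.
  rewrite Se; apply: contraNN => /eqP ce; have : e \notin C.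
    by apply/negP=> /(subsetP sCc); rewrite inE ce eqxx andbF.
  by rewrite -Dd inE Se negbK /c' ce => /eqP->; rewrite mulr0 subrr.
case: (IHn c' _ c'0) => [||D [circD Dx sD]].
- apply: leq_trans le_n; apply: leq_ltn_trans (subset_leq_card sc'c) _.
  by apply/proper_card/properD1/(subsetP sCc).
- by move: cx; rewrite !inE /c' dx mulr0 subr0.
- exists D; split=> //; apply: subset_trans sD (subset_trans sc'c _).
  exact: subsetDl.
Qed.

(* Strong circuit elimination, by clearing the coordinate [p]. *)
Lemma circuit_elim M C D x p : circuit M C -> circuit M D ->
    x \in C -> x \notin D -> p \in C -> p \in D ->
  exists C', [/\ circuit M C', x \in C' & C' \subset (C :|: D) :\ p].
Proof.
move=> circC circD Cx D'x Cp Dp.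
have [c c0 Dc] := circuit_relation circC; have [d d0 Dd] := circuit_relation circD.
have Sx := subsetP (circuit_sub circC) x Cx.
have Sp := subsetP (circuit_sub circC) p Cp.
have dp : d p != 0 by move: Dp; rewrite -Dd inE Sp.
have dx : d x = 0 by apply/eqP; move: D'x; rewrite -Dd inE Sx negbK.
have cx : c x != 0 by move: Cx; rewrite -Dc inE Sx.
pose c' e := c e - (c p / d p) * d e.
have c'0 : relation M c' by apply: relationB.
have c'x : x \in support M c' by rewrite inE Sx /c' dx mulr0 subr0.
have [C' [circC' C'x sC']] := circuit_in_support c'0 c'x.
exists C'; split=> //; apply: subset_trans sC' _; apply/subsetP=> e.
rewrite in_setD1 in_setU -Dc -Dd !inE => /andP[-> /=].
have [->|_] := eqVneq e p; first by rewrite /c' divfK // subrr eqxx.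
apply: contraNT; rewrite negb_or !negbK => /andP[/eqP ce /eqP de].
by rewrite /c' ce de mulr0 subrr.
Qed.

(** Two eliminations replace D by a circuit H through z that still meets C, while [C :|: H] loses
    the element q of [C :|: D]; hence the induction on the size of the union. *)
Lemma circuit_trans M C D x z : circuit M C -> circuit M D ->
    x \in C -> z \in D -> C :&: D != set0 ->
  exists C', [/\ circuit M C', x \in C' & z \in C'].
Proof.
have [n] := ubnP #|C :|: D|; elim: n D => // n IHn D.
rewrite ltnS => le_n circC circD Cx Dz /set0Pn[p /setIP[Cp Dp]].
have [Dx|D'x] := boolP (x \in D); first by exists D.
have [G [circG Gx sG]] := circuit_elim circC circD Cx D'x Cp Dp.
have [Gz|G'z] := boolP (z \in G); first by exists G.
have /subsetPn[q Gq C'q] : ~~ (G \subset C).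
  apply/negP=> /(circuit_min_sub circC circG) DG.
  by move: (subsetP sG p); rewrite DG Cp setD11 => /(_ isT).
have Dq : q \in D.
  by have := subsetP sG q Gq; rewrite in_setD1 in_setU (negPf C'q) => /andP[].
have [H [circH Hz sH]] := circuit_elim circD circG Dz G'z Dq Gq.
have /subsetPn[w Hw D'w] : ~~ (H \subset D).
  apply/negP=> /(circuit_min_sub circD circH) DH.
  by move: (subsetP sH q); rewrite DH Dq setD11 => /(_ isT).
have Cw : w \in C.
  have := subsetP sH w Hw; rewrite in_setD1 in_setU (negPf D'w) => /andP[_ /= Gw].
  by have := subsetP sG w Gw; rewrite in_setD1 in_setU (negPf D'w) orbF => /andP[].
apply: (IHn H) => //; last by apply/set0Pn; exists w; rewrite inE Cw.
apply: leq_trans le_n; apply: (@leq_ltn_trans #|(C :|: D) :\ q|).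
  apply/subset_leq_card/subsetP=> e /setUP[Ce|He].
    by rewrite in_setD1 in_setU Ce; case: eqP C'q => // <-; rewrite Ce.
  have := subsetP sH e He; rewrite !in_setD1 !in_setU => /andP[-> /=].
  case/orP=> [->|Ge]; first by rewrite orbT.
  by have := subsetP sG e Ge; rewrite in_setD1 in_setU => /andP[].
by apply/proper_card/properD1; rewrite inE Dq orbT.
Qed.

Lemma circuit_restrict M X C :
  circuit (mrestrict M X) C = circuit M C && (C \subset X).
Proof.
have dep Y : Y \subset ground M :&: X -> indep (mrestrict M X) Y = indep M Y.
  by rewrite /indep /= => sY; rewrite sY (subset_trans sY) ?subsetIl.
apply/idP/andP => [/minsetP[/andP[/= sC dC] minC] | [/minsetP[/andP[sC dC] minC] sCX]].
  rewrite dep // in dC; move: (sC); rewrite subsetI => /andP[sCM sCX]; split=> //.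
  apply/minsetP; split=> [|Y /andP[sY dY] sYC]; first by rewrite /= sCM.
  have sYX : Y \subset ground M :&: X by apply: subset_trans sC.
  by apply: minC => //=; rewrite sYX dep.
have sC' : C \subset ground M :&: X by rewrite subsetI sC.
apply/minsetP; split=> [|Y /andP[/= sY dY] sYC] /=; first by rewrite sC' dep.
by rewrite dep // in dY; apply: minC => //=; rewrite dY (subset_trans sYC).
Qed.

(** The classes of the relation of sharing a circuit; by [circuit_trans] they partition the ground
    set. The clause [y == x] provides for coloops, which lie in no circuit. *)
Definition circuit_class M x :=
  [set y in ground M | (y == x) || [exists C, [&& circuit M C, x \in C & y \in C]]].

Lemma circuit_classP M x y :
  reflect (y \in ground M /\ (y = x \/ exists C, [/\ circuit M C, x \in C & y \in C]))
          (y \in circuit_class M x).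
Proof.
rewrite inE; apply: (iffP andP) => -[-> H]; split=> //.
  case/orP: H => [/eqP->|/existsP[C /and3P[*]]]; first by left.
  by right; exists C.
by case: H => [->|[C [cC Cx Cy]]]; rewrite ?eqxx //; apply/orP; right;
  apply/existsP; exists C; apply/and3P.
Qed.

Lemma circuit_class_sub M x : circuit_class M x \subset ground M.
Proof. by apply/subsetP=> y /circuit_classP[]. Qed.

Lemma mem_circuit_class M x : x \in ground M -> x \in circuit_class M x.
Proof. by move=> Sx; apply/circuit_classP; split=> //; left. Qed.

Lemma circuit_sub_class M x y C : circuit M C -> y \in C ->
  y \in circuit_class M x -> C \subset circuit_class M x.
Proof.
move=> circC Cy /circuit_classP[Sy xy]; apply/subsetP=> z Cz.
apply/circuit_classP; split; first exact: (subsetP (circuit_sub circC)).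
right; case: xy => [<-|[D [circD Dx Dy]]]; first by exists C.
by apply: (circuit_trans circD circC) => //; apply/set0Pn; exists y; rewrite inE Dy.
Qed.

Lemma circuit_class_eq M x y : x \in ground M -> y \in circuit_class M x ->
  circuit_class M y = circuit_class M x.
Proof.
move=> Sx xy; have /circuit_classP[Sy] := xy.
case=> [->//|[C [circC Cx Cy]]].
have sx := circuit_sub_class circC Cy xy.
have sy := circuit_sub_class circC Cy (mem_circuit_class Sy).
apply/setP=> z; apply/idP/idP=> /circuit_classP[Sz [->|[D [circD D1 Dz]]]] //.
- by apply: (subsetP (circuit_sub_class circD D1 xy)).
- exact: (subsetP sy).
- by apply: (subsetP (circuit_sub_class circD D1 (subsetP sy x Cx))).
Qed.

Lemma circuit_class_connected M x : x \in ground M ->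
  mconnected (mrestrict M (circuit_class M x)).
Proof.
move=> Sx; apply/forallP=> y; apply/implyP=> /setIP[Sy xy].
apply/forallP=> z; apply/implyP=> /setIP[Sz xz]; apply/implyP=> yz.
have : z \in circuit_class M y by rewrite (circuit_class_eq Sx xy).
case/circuit_classP=> _ [Dz|[C [circC Cy Cz]]]; first by rewrite Dz eqxx in yz.
apply/existsP; exists C; rewrite Cy Cz circuit_restrict circC /=.
by rewrite (circuit_sub_class circC Cy xy).
Qed.

Lemma connected_sub_class M x X : x \in X -> X \subset ground M ->
  mconnected (mrestrict M X) -> X \subset circuit_class M x.
Proof.
move=> Xx sX connX; apply/subsetP=> y Xy; apply/circuit_classP.
split; first exact: (subsetP sX).
have [->|yx] := eqVneq y x; [by left | right].
move/forallP/(_ x)/implyP: connX; rewrite /= inE (subsetP sX) //= Xx => /(_ isT).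
move/forallP/(_ y)/implyP; rewrite /= inE (subsetP sX) //= Xy => /(_ isT).
rewrite eq_sym yx /= => /existsP[C /and3P[]].
by rewrite circuit_restrict => /andP[circC _] Cx Cy; exists C.
Qed.

Lemma circuit_class_component M x : x \in ground M ->
  mcomponent M (circuit_class M x).
Proof.
move=> Sx; apply/maxsetP; split=> [|X /andP[sX connX] sub].
  by rewrite /= circuit_class_sub circuit_class_connected.
apply/eqP; rewrite eqEsubset sub andbT; apply: connected_sub_class => //.
exact/(subsetP sub)/mem_circuit_class.
Qed.

(** A circuit lies inside the class or avoids it, so the claim holds for circuit relations;
    subtracting these one at a time reduces the support of c to the empty set. *)
Lemma circuit_class_relation M x c : x \in ground M -> relation M c ->
  relation (mrestrict M (circuit_class M x)) c.
Proof.
move=> Sx; have [n] := ubnP #|support M c|; elim: n c => // n IHn c.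
rewrite ltnS => le_n c0.
have [sc0|/set0Pn[y cy]] := eqVneq (support M c) set0.
  rewrite /relation /= big1 // => e /setIP[Se _]; have /eqP-> : c e == 0.
    by rewrite -[_ == _]negbK; apply/negP=> ce; move: (in_set0 e); rewrite -sc0 inE Se ce.
  by rewrite scale0r.
have [C [circC Cy sC]] := circuit_in_support c0 cy.
have [d d0 Dd] := circuit_relation circC.
have Sy := subsetP (support_sub M c) y cy.
have dy : d y != 0 by move: Cy; rewrite -Dd inE Sy.
have dX : relation (mrestrict M (circuit_class M x)) d.
  have [meet|/negP sep] := boolP [exists z in C, z \in circuit_class M x].
    have /existsP[z /andP[Cz xz]] := meet.
    have sCx := circuit_sub_class circC Cz xz.
    rewrite /relation /= -[RHS]d0 [RHS](big_setID (circuit_class M x)) /=.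
    rewrite [X in _ + X]big1 ?addr0 // => e /setDP[Se x'e].
    have /eqP-> : d e == 0; last by rewrite scale0r.
    by apply: contraNT x'e => de; apply: (subsetP sCx); rewrite -Dd inE Se.
  rewrite /relation /= big1 // => e /setIP[Se xe].
  have /eqP-> : d e == 0; last by rewrite scale0r.
  rewrite -[_ == _]negbK; apply/negP=> de; apply: sep; apply/existsP; exists e.
  by rewrite xe -Dd inE Se de.
pose c' e := c e - (c y / d y) * d e.
have c'0 : relation M c' by apply: relationB.
have sc'c : support M c' \subset support M c :\ y.
  apply/subsetP=> e; rewrite in_setD1 !inE => /andP[Se].
  have [->|_] := eqVneq e y; first by rewrite /c' divfK // subrr eqxx.
  rewrite Se; apply: contraNN => /eqP ce; have : e \notin C.
    by apply/negP=> /(subsetP sC); rewrite inE ce eqxx andbF.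
  by rewrite -Dd inE Se negbK /c' ce => /eqP->; rewrite mulr0 subrr.
have c'X : relation (mrestrict M (circuit_class M x)) c'.
  apply: IHn c'0; apply: leq_trans le_n.
  by apply: leq_ltn_trans (subset_leq_card sc'c) _; apply/proper_card/properD1.
(* The opposite scalar adds back the subtracted multiple of d and recovers c. *)
have := relationB (- (c y / d y)) c'X dX.
rewrite /relation /c'; congr (_ = _); apply: eq_bigr => e _.
by rewrite mulNr opprK subrK.
Qed.

(** A circuit with elements both in and outside Y would have its relation truncated to Y, giving a
    nonzero relation on a smaller support, against minimality. *)
Lemma connected_unsplit M Y : mconnected M ->
    (forall c, relation M c -> relation (mrestrict M Y) c) ->
  (ground M \subset Y) || [disjoint ground M & Y].
Proof.
move=> connM splitY; apply/orP; case: (boolP (ground M \subset Y)); first by left.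
case/subsetPn=> z Sz Y'z; right; rewrite -setI_eq0.
apply: contraT => /set0Pn[x /setIP[Sx Yx]].
have xz : x != z by apply: contraTneq Yx => ->.
move/forallP/(_ x)/implyP/(_ Sx)/forallP/(_ z)/implyP/(_ Sz)/implyP/(_ xz): connM.
case/existsP=> C /and3P[circC Cx Cz].
have [c c0 Dc] := circuit_relation circC.
have /relation_restrict d0 := splitY c c0.
set d := fun e => _ in d0.
have Dd : support M d = C :&: Y.
  apply/setP=> e; rewrite in_setI -Dc !inE /d.
  by case: (e \in Y); rewrite ?eqxx ?andbF ?andbT.
have : support M d = C.
  apply: circuit_min d0 _ _ => //; rewrite Dd ?subsetIl //.
  by apply/set0Pn; exists x; rewrite inE Cx.
by rewrite Dd => /setP/(_ z); rewrite inE Cz (negPf Y'z).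
Qed.

End LinearRelations.

(** * From elimination forests to the depth *)

Section Contraction.
Variables (F : fieldType) (E : finType).
Implicit Types (M : rmatroid F E) (C : {set E}).

HB.instance Definition _ (V : vectType F) (L : {vspace V}) :=
  GRing.isLinear.Build F V (quotV L) _ (quotv L) (@quotv_is_linear F V L).

Lemma relation_mquotient M (L : {vspace ambient M}) c :
  relation (mquotient L) c <-> \sum_(e in ground M) c e *: vec M e \in L.
Proof.
rewrite /relation /= -quotv_eq0 linear_sum /=.
rewrite [X in _ <-> X == 0](eq_bigr (fun e => c e *: quotv L (vec M e))).
  by split=> /eqP.
by move=> e _; rewrite linearZ.
Qed.

Lemma mrestrict_ground M : mrestrict M (ground M) = M.
Proof. by case: M => V S v; rewrite /mrestrict /= setIid. Qed.

Lemma mdelete_restrict M e : mdelete M e = mrestrict M [set~ e].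
Proof. by rewrite /mdelete setDE. Qed.

Lemma mrank_eq0 M : mrank M = 0%N <-> {in ground M, forall e, vec M e = 0}.
Proof.
rewrite /mrank; split=> [/eqP|v0]; last apply/eqP; rewrite dimv_eq0.
  move=> /eqP span0 e Se; apply/eqP; rewrite -memv0 -span0.
  by apply/memv_span/map_f; rewrite mem_enum.
rewrite -subv0; apply/span_subvP=> u /mapP[e].
by rewrite mem_enum => Se ->; rewrite v0 // mem0v.
Qed.

Lemma mconnected_small M : (#|ground M| <= 1)%N -> mconnected M.
Proof.
move=> /card_le1_eqP eqM; apply/forallP=> x; apply/implyP=> Sx.
apply/forallP=> y; apply/implyP=> Sy; apply/implyP.
by rewrite (eqM x y) ?eqxx.
Qed.

Lemma csdd_rank0 M : mrank M = 0%N -> csdd M = 0%N.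
Proof. by move=> rk0; rewrite csddE /csdd_step rk0. Qed.

Lemma csdd_empty M : ground M = set0 -> csdd M = 0%N.
Proof. by move=> S0; apply/csdd_rank0/mrank_eq0 => e; rewrite S0 inE. Qed.

Lemma csdd_single M : #|ground M| = 1%N -> (csdd M <= 1)%N.
Proof. by move=> S1; rewrite csddE /csdd_step S1; case: ifP. Qed.

Lemma csdd_disconnected M : ~~ mconnected M -> mrank M != 0%N ->
  csdd M = \max_(C | mcomponent M C) csdd (mrestrict M C).
Proof.
move=> nconn rkM; rewrite csddE /csdd_step (negPf rkM) nconn.
by case: eqP => // S1; rewrite mconnected_small ?S1 in nconn.
Qed.

(** Components are connected restrictions, and a disconnected matroid takes the maximum over
    them. *)
Lemma csdd_le_connected M k :
    (forall C, C \subset ground M -> mconnected (mrestrict M C) ->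
       (csdd (mrestrict M C) <= k)%N) ->
  (csdd M <= k)%N.
Proof.
move=> le_k; have [connM|nconn] := boolP (mconnected M).
  by rewrite -(mrestrict_ground M) le_k // mrestrict_ground.
have [rk0|rkM] := eqVneq (mrank M) 0%N; first by rewrite csdd_rank0.
rewrite csdd_disconnected //; apply/bigmax_leqP=> C /maxsetp/andP[sC connC].
exact: le_k.
Qed.

Lemma csdd_le_delete M e : mconnected M -> e \in ground M ->
  (csdd M <= (csdd (mdelete M e)).+1)%N.
Proof.
move=> connM Se; rewrite csddE /csdd_step connM /=.
case: ifP => // _; case: ifP => // _; rewrite ltnS geq_min.
by apply/orP; left; apply: nat_min_le; exists e.
Qed.

Lemma csdd_le_quotient M (L : {vspace ambient M}) : mconnected M ->
  \dim L = 1%N -> (csdd M <= (csdd (mquotient L)).+1)%N.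
Proof.
move=> connM dL; rewrite csddE /csdd_step connM /=.
case: ifP => // _; case: ifP => // _; rewrite ltnS geq_min.
by apply/orP; right; apply: nat_min_le; exists L.
Qed.

Lemma csdd_connected M : mconnected M -> mrank M != 0%N -> #|ground M| != 1%N ->
  (exists2 e, e \in ground M & csdd M = (csdd (mdelete M e)).+1) \/
  (exists2 L : {vspace ambient M}, \dim L = 1%N & csdd M = (csdd (mquotient L)).+1).
Proof.
move=> connM rkM S1; rewrite csddE /csdd_step (negPf rkM) (negPf S1) connM /= /minn.
set P := fun k => exists2 e, _ & k = csdd (mdelete M e).
set Q := fun k => exists2 L : {vspace ambient M}, _ & k = csdd (mquotient L).
case: ifP => _; [left | right].
  have [e Se] := deletion_exists rkM.
  have [|e' Se' ->] := @nat_min_in P (csdd (mdelete M e)); first by exists e.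
  by exists e'.
have [L dL] := line_exists rkM.
have [|L' dL' ->] := @nat_min_in Q (csdd (mquotient L)); first by exists L.
by exists L'.
Qed.

End Contraction.

(** * Row sets representing a matroid, and the bound of the depth by tree-depth *)

Section IncidenceRepresentation.
Variables (F : fieldType) (I E : finType).
Implicit Types (M : rmatroid F E) (B : I -> E -> F) (R : {set I}) (S : {set E}).

Definition bipartite_graph B : rel (I + E) := fun x y =>
  match x, y with
  | inl r, inr c | inr c, inl r => B r c != 0
  | _, _ => false
  end.

Definition vertices R S : {set I + E} :=
  [set x | match x with inl i => i \in R | inr e => e \in S end].

(** Rows form a subset of the fixed type [I], matching vertex removal in [td_le]; comparing
    relations instead of vectors lets the ambient space change under [mquotient]. *)
Definition represents B R M := forall c,
  relation M c <-> {in R, forall i, \sum_(e in ground M) c e * B i e = 0}.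

Lemma vertices_subP R S (X : {set I + E}) :
  reflect ({in R, forall i, inl i \in X} /\ {in S, forall e, inr e \in X})
          (vertices R S \subset X).
Proof.
apply: (iffP subsetP) => [sX | [sR sS] [i|e]]; rewrite ?inE; [|exact: sR|exact: sS].
by split=> [i Ri|e Se]; apply: sX; rewrite inE.
Qed.

Lemma represents_restrict B R M (C : {set E}) : C \subset ground M ->
  represents B R M -> represents B R (mrestrict M C).
Proof.
move=> sC rep c; split=> [/relation_restrict/rep c0 i Ri | c0].
  rewrite -[RHS](c0 i Ri) [RHS](big_setID C) /= [X in _ + X]big1 ?addr0.
    by apply: eq_bigr => e /setIP[_ ->].
  by move=> e /setDP[_ /negPf->]; rewrite mul0r.
apply/relation_restrict/rep => i Ri; rewrite -[RHS](c0 i Ri) (big_setID C) /=.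
rewrite [X in _ + X]big1 ?addr0; first by apply: eq_bigr => e /setIP[_ ->].
by move=> e /setDP[_ /negPf->]; rewrite mul0r.
Qed.

Section TwoSides.
Variables (B : I -> E -> F) (R : {set I}) (M : rmatroid F E) (X Y : {set I + E}).
Hypothesis nadj : nonadjacent (bipartite_graph B) X Y.
Hypothesis sXY : vertices R (ground M) \subset X :|: Y.
Hypothesis rep : represents B R M.

Lemma opposite_entry0 i e : i \in R -> inl i \notin X -> inr e \in X -> B i e = 0.
Proof.
move=> Ri X'i Xe; have /vertices_subP[/(_ i Ri)] := sXY.
rewrite inE (negPf X'i) /= => Yi _.
by have /andP[] := nadj Xe Yi; rewrite /= negbK => /eqP.
Qed.

Lemma represents_side : {in ground M, forall e, inr e \in X} ->
  represents B [set i in R | inl i \in X] M.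
Proof.
move=> sX c; split=> [/rep c0 i /setIdP[Ri _]|c0]; first exact: c0.
apply/rep=> i Ri; have [Xi|X'i] := boolP (inl i \in X).
  by apply: c0; rewrite inE Ri.
by rewrite big1 // => e Se; rewrite opposite_entry0 ?mulr0 ?sX.
Qed.

(** Truncating c to the columns in X preserves the sum over a row in X, which vanishes on the other
    columns, and annihilates the sum over any other row, which vanishes on the columns in X. *)
Lemma relation_side c : relation M c ->
  relation (mrestrict M [set e | inr e \in X]) c.
Proof.
move=> /rep c0; apply/relation_restrict/rep=> i Ri.
have [Xi|X'i] := boolP (inl i \in X).
  rewrite -[RHS](c0 i Ri); apply: eq_bigr => e Se; rewrite inE.
  case: (boolP (inr e \in X)) => // X'e.
  have /vertices_subP[_ /(_ e Se)] := sXY; rewrite inE (negPf X'e) /= => Ye.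
  by have /andP[] := nadj Xi Ye; rewrite /= negbK => /eqP-> _; rewrite mul0r mulr0.
rewrite big1 // => e Se; rewrite inE.
case: ifP => Xe; last by rewrite mul0r.
by rewrite opposite_entry0 ?mulr0.
Qed.

End TwoSides.

Lemma nonadjacent_sym (V : finType) (g : rel V) X Y :
  nonadjacent g X Y -> nonadjacent g Y X.
Proof. by move=> nadj x y Yx Xy; rewrite andbC nadj. Qed.

(* Dropping row [r] contracts the line of the vectors whose coordinates vanish
   outside [r], and changes nothing when that line is zero. *)
Lemma represents_drop_row B R M r : r \in R -> represents B R M ->
  represents B (R :\ r) M \/
  exists2 L : {vspace ambient M}, \dim L = 1%N & represents B (R :\ r) (mquotient L).
Proof.
move=> Rr rep; pose coord c i := \sum_(e in ground M) c e * B i e.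
have [[c [c0 cr]]|nc] := pselect (exists c,
    {in R :\ r, forall i, coord c i = 0} /\ coord c r != 0).
  right; pose v := \sum_(e in ground M) c e *: vec M e.
  have coordB a d i : coord (fun e => d e - a * c e) i = coord d i - a * coord c i.
    rewrite /coord mulr_sumr -sumrB; apply: eq_bigr => e _.
    by rewrite mulrBl mulrA.
  have relB a d : relation M (fun e => d e - a * c e) <->
      \sum_(e in ground M) d e *: vec M e = a *: v.
    rewrite /relation (eq_bigr (fun e => d e *: vec M e - a *: (c e *: vec M e))).
      by rewrite sumrB -scaler_sumr; split=> [/eqP|->]; rewrite ?subrr // subr_eq0 => /eqP.
    by move=> e _; rewrite scalerBl scalerA.
  exists <[v]>%VS.
    rewrite dim_vline; case: eqP => // v0; case/eqP: cr; exact: (rep c).1.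
  move=> d; split=> [/relation_mquotient/vlineP[a /relB/rep d0] i /setD1P[ir Ri]|d0].
    have R'i : i \in R :\ r by rewrite in_setD1 ir.
    by have := d0 i Ri; rewrite -/(coord _ i) coordB (c0 i R'i) mulr0 subr0.
  (* This multiple of c agrees with d in row r, and both vanish in the remaining rows, so their
     difference is a relation of M. *)
  apply/relation_mquotient/vlineP; exists (coord d r / coord c r); apply/relB/rep.
  move=> i Ri; rewrite -/(coord _ i) coordB; have [->|ir] := eqVneq i r.
    by rewrite divfK // subrr.
  have R'i : i \in R :\ r by rewrite in_setD1 ir.
  by rewrite (c0 i R'i) mulr0 subr0; apply: d0.
left=> c; split=> [/rep c0 i /setD1P[_]|c0]; first exact: c0.
apply/rep=> i Ri; have [->|ir] := eqVneq i r; last by apply: c0; rewrite in_setD1 ir.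
by apply: contrapT => /eqP cr; apply: nc; exists c.
Qed.

(** Each removed vertex lowers the depth by at most one. Strictness comes from the end of the
    process: a last column takes a level of its own, and if it is nonzero, some row takes
    another. *)
Lemma csdd_lt_td_le B k X : td_le (bipartite_graph B) k X ->
  forall M R, ground M != set0 -> vertices R (ground M) \subset X ->
  represents B R M -> (csdd M < k)%N.
Proof.
have reduce k' (Y : {set I + E}) :
    (forall M R, mconnected M -> ground M != set0 ->
       vertices R (ground M) \subset Y -> represents B R M -> (csdd M < k')%N) ->
    forall M R, ground M != set0 -> vertices R (ground M) \subset Y ->
       represents B R M -> (csdd M < k')%N.
  move=> conn M R /set0Pn[x Sx] sY rep.
  have sub (C : {set E}) : C \subset ground M -> C != set0 -> mconnected (mrestrict M C) ->
      (csdd (mrestrict M C) < k')%N.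
    move=> sC C0 connC; apply: (conn _ R) => //=; first by rewrite (setIidPr sC).
      apply/vertices_subP=> /=; have /vertices_subP[sR sS] := sY.
      by split=> [|e /setIP[Se _]]; [exact: sR | exact: sS].
    exact: represents_restrict.
  (* Positivity turns the strict bound into one by [k'.-1], the form [csdd_le_connected] accepts; it
     comes from a one-element restriction, which is connected. *)
  have k'_gt0 : (0 < k')%N.
    apply: leq_ltn_trans (sub [set x] _ _ _); rewrite ?sub1set //.
      by apply/set0Pn; exists x; rewrite set11.
    by apply: mconnected_small; rewrite -(cards1 x) subset_leq_card // subsetIr.
  rewrite -(prednK k'_gt0) ltnS; apply: csdd_le_connected => C sC connC.
  rewrite -ltnS (prednK k'_gt0); have [->|C0] := eqVneq C set0; last exact: sub.
  by rewrite csdd_empty //= setI0.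
elim=> {k X}.
- move=> k M R /set0Pn[x Sx] /vertices_subP[_ /(_ x Sx)]; by rewrite inE.
- move=> k X v Xv td IH; apply: reduce => M R connM S0 sX rep.
  have /vertices_subP[sRX sSX] := sX.
  (* X may be larger than the vertex set of the represented matroid; removing a vertex outside that
     set leaves M unchanged. *)
  have sub_skip : v \notin vertices R (ground M) -> (csdd M < k.+1)%N.
    move=> V'v; apply: ltnW; rewrite ltnS; apply: (IH M R) => //.
    apply/subsetP=> x Vx; rewrite in_setD1 (subsetP sX) // andbT.
    by apply: contraNneq V'v => <-.
  case: v Xv td IH sub_skip => [r|e] Xv td IH; rewrite inE => sub_skip.
    have [Rr|/sub_skip//] := boolP (r \in R).
    have sX' : vertices (R :\ r) (ground M) \subset X :\ inl r.
      apply/vertices_subP; split=> [i /setD1P[ir Ri]|e Se]; rewrite in_setD1 ?sSX //.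
      by rewrite sRX // andbT; apply: contraNneq ir => -[->].
    have [repM|[L dL repL]] := represents_drop_row Rr rep.
      by apply: ltnW; rewrite ltnS; apply: (IH M (R :\ r)).
    rewrite ltnS; apply: leq_trans (csdd_le_quotient connM dL) _.
    exact: (IH (mquotient L) (R :\ r)).
  have [Se|/sub_skip//] := boolP (e \in ground M).
  have sX' : vertices R (ground M :\ e) \subset X :\ inr e.
    apply/vertices_subP; split=> [i Ri|y /setD1P[ye Sy]]; rewrite in_setD1 ?sRX //.
    by rewrite sSX // andbT; apply: contraNneq ye => -[->].
  have [Se0|S'0] := eqVneq (ground M :\ e) set0; last first.
    rewrite ltnS; apply: leq_trans (csdd_le_delete connM Se) _.
    apply: (IH (mdelete M e) R) => //; rewrite mdelete_restrict.
    rewrite (_ : mrestrict _ _ = mrestrict M (ground M :\ e)).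
      by apply: represents_restrict => //; apply: subsetDl.
    by rewrite /mrestrict -setDE (setIidPr (subsetDl _ _)).
  (* The induction hypothesis does not cover the empty deletion. The depth is at most 1 here; if k
     is 0, no row remains, so e is a loop and the rank is 0. *)
  have DS : ground M = [set e] by rewrite -(setD1K Se) Se0 setU0.
  have [rk0|rkM] := eqVneq (mrank M) 0%N; first by rewrite csdd_rank0.
  rewrite ltnS; apply: (@leq_trans 1); first by rewrite csdd_single // DS cards1.
  case: k td {IH sub_skip} => // td; case/eqP: rkM; apply/mrank_eq0 => y.
  rewrite DS => /set1P->.
  have : relation M (fun => 1).
    apply/rep => i Ri; have : inl i \in X :\ inr e by rewrite in_setD1 sRX.
    by rewrite (td_le_height0 td) inE.
  by rewrite /relation DS big_set1 scale1r.
- move=> k X Y dXY nXY _ IHX _ IHY; apply: reduce => M R connM S0 sXY rep.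
  have side Z Z' : nonadjacent (bipartite_graph B) Z Z' ->
      vertices R (ground M) \subset Z :|: Z' ->
      (forall M R, ground M != set0 -> vertices R (ground M) \subset Z ->
         represents B R M -> (csdd M < k)%N) ->
      {in ground M, forall e, inr e \in Z} -> (csdd M < k)%N.
    move=> nZ sZ IHZ gZ; apply: (IHZ M [set i in R | inl i \in Z]) => //.
      by apply/vertices_subP; split=> // i /setIdP[].
    exact: (represents_side nZ sZ rep gZ).
  have := connected_unsplit connM (relation_side nXY sXY rep).
  case/orP=> [/subsetP sX | /disjointFr disjX].
    by apply: (side X Y) => // e Se; have := sX e Se; rewrite inE.
  apply: (side Y X) => //; [exact: nonadjacent_sym | by rewrite setUC |].
  move=> e Se; have /vertices_subP[_ /(_ e Se)] := sXY.
  by rewrite inE; have := disjX e Se; rewrite inE => ->.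
Qed.

End IncidenceRepresentation.

(** * From the depth to elimination forests *)

Section Ranks.
Variables (F : fieldType) (E : finType).
Implicit Types (M : rmatroid F E) (C : {set E}).

Lemma mrank_restrict_le M C : (mrank (mrestrict M C) <= mrank M)%N.
Proof.
apply/dimvS/sub_span => u /mapP[e]; rewrite mem_enum => /setIP[Se _] ->.
by apply: map_f; rewrite mem_enum.
Qed.

Lemma mrank_mquotient M (L : {vspace ambient M}) :
  (\dim (<<[seq vec M e | e <- enum (ground M)]>> :&: L) + mrank (mquotient L))%N = mrank M.
Proof.
rewrite /mrank /= -[RHS](limg_ker_dim (linfun (quotv L))) limg_span; congr (_ + _)%N.
  by congr (\dim (_ :&: _)%VS); apply/vspaceP=> u; rewrite memv_ker lfunE quotv_eq0.
by rewrite -map_comp; congr (\dim <<_>>%VS); apply: eq_map => e /=; rewrite lfunE.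
Qed.

Definition circuit_classes M := [set circuit_class M x | x in ground M].

Lemma sum_circuit_classes M (V : nmodType) (f : E -> V) :
  \sum_(e in ground M) f e = \sum_(C in circuit_classes M) \sum_(e in ground M :&: C) f e.
Proof.
rewrite (partition_big (circuit_class M) (mem (circuit_classes M))); last first.
  by move=> e Se; apply: imset_f.
apply: eq_bigr => C /imsetP[x Sx ->]; apply: eq_bigl => e.
rewrite in_setI; apply: andb_id2l => Se; apply/eqP/idP => [<-|xe].
  exact: mem_circuit_class.
exact: circuit_class_eq.
Qed.

(** The spans of the classes form a direct sum: vectors summing to zero give, once their
    coefficients are glued over the classes, a relation of M, which splits by
    [circuit_class_relation]. *)
Lemma mrank_circuit_classes M :
  (\sum_(C in circuit_classes M) mrank (mrestrict M C) <= mrank M)%N.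
Proof.
pose U C := <<[seq vec M e | e <- enum (ground M :&: C)%SET]>>%VS.
suff /directvP/= <- : directv (\sum_(C in circuit_classes M) U C).
  apply/dimvS/subv_sumP=> C _; apply: sub_span => u /mapP[e].
  by rewrite mem_enum => /setIP[Se _] ->; apply: map_f; rewrite mem_enum.
apply/directv_sum_independent => us Uus us0 C CC.
have /choice[c cE] (D : {set E}) : exists c : E -> F,
    D \in circuit_classes M -> us D = \sum_(e in ground M :&: D) c e *: vec M e.
  have [DC|] := boolP (D \in circuit_classes M); last by exists (fun => 0).
  by have /mem_span_family[c ->] := Uus D DC; exists c.
pose d e := c (circuit_class M e) e.
have dE D : D \in circuit_classes M ->
    \sum_(e in ground M :&: D) d e *: vec M e = us D.
  move=> DC; rewrite cE //; apply: eq_bigr => e /setIP[Se De].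
  by case/imsetP: DC De => x Sx -> xe; rewrite /d (circuit_class_eq Sx).
have d0 : relation M d.
  by rewrite /relation sum_circuit_classes -[RHS]us0; apply: eq_bigr => D /dE.
case/imsetP: (CC) => x Sx Dx; rewrite -dE // Dx.
exact: circuit_class_relation.
Qed.

End Ranks.

(** Allots to each component its own rows, at least as many as its rank. *)
Lemma disjoint_subsets (I : finType) (J : eqType) (s : seq J) (r : J -> nat) (R : {set I}) :
    uniq s -> (\sum_(j <- s) r j <= #|R|)%N ->
  exists f : J -> {set I},
    [/\ {in s, forall j, f j \subset R}, {in s, forall j, (r j <= #|f j|)%N} &
        {in s &, forall j k, j != k -> [disjoint f j & f k]}].
Proof.
elim: s R => [|j s IHs] R /=; first by exists (fun=> set0); split.
case/andP=> s'j Us; rewrite big_cons => le_R.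
pose A := [set i in take (r j) (enum R)].
have cardA : #|A| = r j.
  rewrite cardsE (card_uniqP _) ?take_uniq ?enum_uniq // size_takel // -cardE.
  exact: leq_trans (leq_addr _ _) le_R.
have sAR : A \subset R.
  by apply/subsetP=> i; rewrite inE => /mem_take; rewrite mem_enum.
have [|f [sf rf df]] := IHs (R :\: A) Us.
  rewrite cardsDS // cardA leq_subRL ?leq_subLR // -[r j]addn0.
  by rewrite (leq_trans _ le_R) ?leq_add2l.
have neq k : k \in s -> (k == j) = false by move=> sk; apply: contraNF s'j => /eqP<-.
have dA k : k \in s -> [disjoint A & f k].
  move=> sk; rewrite disjoint_sym disjoints_subset.
  by apply: subset_trans (sf k sk) _; rewrite setDE subsetIr.
exists (fun k => if k == j then A else f k); split.
- move=> k; rewrite inE; case: eqP => //= _ sk.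
  exact: subset_trans (sf k sk) (subsetDl _ _).
- by move=> k; rewrite inE; case: eqP => [->|_] //=; [rewrite cardA | apply: rf].
- move=> k l; rewrite !inE; have [->|_] /= := eqVneq k j.
    by have [->|_] //= := eqVneq l j; rewrite ?eqxx // => _ sl _; apply: dA.
  have [->|_] /= := eqVneq l j; last exact: df.
  by move=> sk _ _; rewrite disjoint_sym dA.
Qed.

(** * Construction of representing matrices of small tree-depth *)

Section UpperBound.
Variables (F : fieldType) (I E : finType).
Implicit Types (M : rmatroid F E) (B : I -> E -> F) (R : {set I}).

Definition depth_representable M := forall R, (mrank M <= #|R|)%N ->
  exists2 B, represents B R M &
    td_le (bipartite_graph B) (csdd M).+1 (vertices R (ground M)).

Lemma depth_representable_rank0 M : mrank M = 0%N -> depth_representable M.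
Proof.
move=> rk0 R _; exists (fun _ _ => 0).
  move=> c; split=> [_ i _|_]; first by rewrite big1 // => e _; rewrite mulr0.
  by rewrite /relation big1 // => e Se; rewrite (mrank_eq0 M).1 ?scaler0.
apply: td_le_mono (td_le_edgeless _) => //.
by case=> [i|e] [j|y] _ _ //=; rewrite eqxx.
Qed.

Lemma depth_representable_single M :
  mrank M != 0%N -> #|ground M| = 1%N -> depth_representable M.
Proof.
move=> rkM /eqP/cards1P[e DS] R rkR.
have [r Rr] : exists r, r \in R.
  by apply/set0Pn; rewrite -card_gt0; apply: leq_trans rkR; rewrite lt0n.
have ve : vec M e != 0.
  by apply: contra rkM => /eqP ve; apply/eqP/mrank_eq0 => y; rewrite DS => /set1P->.
exists (fun i _ => if i == r then 1 else 0).
  move=> c; rewrite /relation DS big_set1; split=> [/eqP|/(_ r Rr)].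
    by rewrite scaler_eq0 (negPf ve) orbF => /eqP ce i _; rewrite big_set1 ce mul0r.
  by rewrite big_set1 eqxx mulr1 => ->; rewrite scale0r.
have -> : csdd M = 1%N by rewrite csddE /csdd_step (negPf rkM) DS cards1.
apply: (@TdRoot _ _ _ _ (inr e)); first by rewrite inE DS set11.
have rows x : x \in vertices R (ground M) :\ inr e -> exists i, x = inl i.
  case: x => [i|y]; first by exists i.
  by case/setD1P=> ne; rewrite inE DS => /set1P Dy; rewrite Dy eqxx in ne.
by apply: td_le_edgeless => _ _ /rows[i ->] /rows[j ->].
Qed.

(** The matrix is block diagonal, one block per circuit class on the rows allotted to it; the rows
    left over are zero and become isolated vertices. *)
Lemma depth_representable_disconnected M : mrank M != 0%N -> ~~ mconnected M ->
    (forall C, mcomponent M C -> depth_representable (mrestrict M C)) ->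
  depth_representable M.
Proof.
move=> rkM nconn IH R rkR; set CC := circuit_classes M.
have [|Rf [sRf rRf dRf]] := @disjoint_subsets I _ (enum CC)
    (fun C => mrank (mrestrict M C)) R (enum_uniq _).
  by rewrite big_enum; apply: leq_trans (mrank_circuit_classes M) rkR.
have /choice[Bf BfP] (C : {set E}) : exists B, C \in CC ->
    represents B (Rf C) (mrestrict M C) /\
    td_le (bipartite_graph B) (csdd M).+1 (vertices (Rf C) C).
  have [CC_C|] := boolP (C \in CC); last by exists (fun _ _ => 0).
  have compC : mcomponent M C.
    by case/imsetP: CC_C => x Sx ->; apply: circuit_class_component.
  have [|B repB tdB] := IH C compC (Rf C); first by apply: rRf; rewrite mem_enum.
  exists B => _; split=> //; rewrite /= (setIidPr _) in tdB.
    apply: td_le_mono tdB; rewrite ltnS (csdd_disconnected nconn rkM).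
    exact: (bigmax_sup C).
  by case/maxsetp/andP: compC.
pose cls := circuit_class M.
have clsCC e : e \in ground M -> cls e \in CC by move=> Se; apply: imset_f.
pose B i e := if i \in Rf (cls e) then Bf (cls e) i e else 0.
have block i x e : x \in ground M -> e \in ground M -> i \in Rf (cls x) ->
    B i e = if e \in cls x then Bf (cls x) i e else 0.
  move=> Sx Se Rxi; rewrite /B; case: ifP => [Rei|R'ei].
    have Dxe : cls e = cls x.
      apply: contraTeq Rei => ne.
      have := dRf (cls e) (cls x); rewrite !mem_enum => /(_ (clsCC _ Se) (clsCC _ Sx) ne).
      by move=> /disjointFl ->.
    by rewrite Dxe -Dxe mem_circuit_class.
  case: ifP => // xe; move: R'ei; rewrite /cls (circuit_class_eq Sx xe).
  by rewrite -/(cls x) Rxi.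
have row_sum c i x : x \in ground M -> i \in Rf (cls x) ->
    \sum_(e in ground M) c e * B i e = \sum_(e in ground M :&: cls x) c e * Bf (cls x) i e.
  move=> Sx Rxi; rewrite (big_setID (cls x)) /= [X in _ + X]big1 ?addr0.
    by apply: eq_bigr => e /setIP[Se xe]; rewrite (block i x) // xe.
  by move=> e /setDP[Se x'e]; rewrite (block i x) // (negPf x'e) mulr0.
exists B.
  move=> c; split=> [c0 i Ri | c0].
    have [/existsP[x /andP[Sx Rxi]]|nx] := boolP [exists x in ground M, i \in Rf (cls x)].
      rewrite (row_sum _ _ x) //; have [repB _] := BfP (cls x) (clsCC x Sx).
      by apply: ((repB c).1 _ i Rxi); apply: circuit_class_relation.
    rewrite big1 // => e Se; rewrite /B; case: ifP => [Rei|]; last by rewrite mulr0.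
    by case/existsP: nx; exists e; rewrite Se.
  rewrite /relation sum_circuit_classes big1 // => C /imsetP[x Sx ->].
  have [repB _] := BfP (cls x) (clsCC x Sx); apply/(repB c) => i Rxi /=.
  rewrite -(row_sum c i x) //; apply: c0; apply: (subsetP (sRf (cls x) _)) => //.
  by rewrite mem_enum clsCC.
pose R0 := R :\: \bigcup_(C in CC) Rf C.
have -> : vertices R (ground M) =
    vertices R0 set0 :|: \bigcup_(C <- enum CC) vertices (Rf C) C.
  apply/setP=> -[i|e]; rewrite bigcup_seq !inE.
    rewrite /R0; case: (boolP (i \in \bigcup_(C in CC) Rf C)) => /= [Ui|U'i].
      have /bigcupP[C CC_C Ci] := Ui.
      have -> : i \in R by apply: (subsetP (sRf C _)); rewrite ?mem_enum.
      by apply/esym/bigcupP; exists C; rewrite ?mem_enum ?inE.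
    case: (i \in R) => //=; apply/esym/negP=> /bigcupP[C].
    rewrite mem_enum inE => CC_C Ci; case/negP: U'i; apply/bigcupP; by exists C.
  apply/idP/bigcupP => [Se|[C]].
    by exists (cls e); rewrite ?mem_enum ?clsCC // inE mem_circuit_class.
  rewrite mem_enum inE => /imsetP[x Sx ->] /=; exact: (subsetP (circuit_class_sub _ _)).
have isolated i e : i \in R0 -> e \in ground M -> B i e = 0.
  case/setDP=> _ U'i Se; rewrite /B; case: ifP => // Rei; case/negP: U'i.
  by apply/bigcupP; exists (cls e); rewrite ?clsCC.
have CCsub C e : C \in CC -> e \in C -> e \in ground M /\ cls e = C.
  case/imsetP=> x Sx -> xe; split; first exact: (subsetP (circuit_class_sub M x)).
  exact: circuit_class_eq.
apply: TdUnion.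
- rewrite bigcup_seq; apply: bigcup_disjoint => C; rewrite mem_enum => CC_C.
  rewrite -setI_eq0; apply/eqP/setP=> -[i|e]; rewrite !inE //.
  by apply/negP=> /andP[/andP[/negP U'i _] Ci]; apply: U'i; apply/bigcupP; exists C.
- move=> x y Vx; rewrite bigcup_seq => /bigcupP[C]; rewrite mem_enum => CC_C.
  case: x Vx => [i|e]; rewrite [_ \in vertices _ _]inE; last by rewrite inE.
  case: y => [j|e] R0i; rewrite [_ \in vertices _ _]inE //= => Ce.
  by have [Se _] := CCsub C e CC_C Ce; rewrite isolated ?eqxx.
- apply: (@td_le_mono _ _ 1) => //; apply: td_le_edgeless.
  by case=> [i|e] [j|y]; rewrite !inE.
- apply: td_le_bigcup; first exact: enum_uniq.
  + move=> C D; rewrite !mem_enum => CC_C CC_D CD.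
    rewrite -setI_eq0; apply/eqP/setP=> -[i|e]; rewrite !inE.
      apply/andP=> -[Ci Di]; have := dRf C D; rewrite !mem_enum.
      by move=> /(_ CC_C CC_D CD)/disjointFr/(_ Ci); rewrite Di.
    apply/andP=> -[Ce De]; case/eqP: CD.
    by have [_ <-] := CCsub C e CC_C Ce; have [_ <-] := CCsub D e CC_D De.
  + have off C D i e : C \in CC -> D \in CC -> C != D -> i \in Rf C -> e \in D -> B i e = 0.
      move=> CC_C CC_D CD Ci De; have [Se De'] := CCsub D e CC_D De.
      rewrite /B De'; have := dRf C D; rewrite !mem_enum.
      by move=> /(_ CC_C CC_D CD)/disjointFr/(_ Ci) ->.
    move=> C D; rewrite !mem_enum => CC_C CC_D CD [i|e] [j|y]; rewrite !inE //= => H1 H2.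
      by rewrite (off C D) ?eqxx.
    by rewrite (off D C) ?eqxx // eq_sym.
  + move=> C; rewrite mem_enum => CC_C; have [_ tdB] := BfP C CC_C.
    apply: td_le_sub tdB => -[i|e] [j|y]; rewrite !inE //= /B => H1 H2.
      have [Sy ->] := CCsub C y CC_C H2; by rewrite H1.
    have [Sy ->] := CCsub C e CC_C H1; by rewrite H2.
Qed.

(** A circuit joins e to another element, so e is not a coloop. The coefficients a then tell which
    combination of columns restores a deleted e. *)
Lemma connected_in_span M e : mconnected M -> e \in ground M -> #|ground M| != 1%N ->
  exists a : E -> F, vec M e = \sum_(y in ground M :\ e) a y *: vec M y.
Proof.
move=> connM Se S1; have [x /setD1P[xe Sx]] : exists x, x \in ground M :\ e.
  apply/set0Pn; apply: contra S1 => /eqP S0.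
  by rewrite -(setD1K Se) S0 setU0 cards1.
move/forallP/(_ x)/implyP/(_ Sx)/forallP/(_ e)/implyP/(_ Se)/implyP/(_ xe): connM.
case/existsP=> C /and3P[circC _ Ce]; have [c c0 Dc] := circuit_relation circC.
have ce : c e != 0 by move: Ce; rewrite -Dc inE Se.
exists (fun y => - (c y / c e)); apply: (scalerI ce); rewrite scaler_sumr.
move: c0; rewrite /relation (big_setD1 e) //= => /eqP; rewrite addr_eq0 => /eqP->.
rewrite -sumrN; apply: eq_bigr => y _.
by rewrite scalerA mulrN mulrC divfK // scaleNr.
Qed.

Lemma depth_representable_delete M e :
    mconnected M -> e \in ground M -> #|ground M| != 1%N ->
    csdd M = (csdd (mdelete M e)).+1 -> depth_representable (mdelete M e) ->
  depth_representable M.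
Proof.
move=> connM Se S1 csddM IH R rkR; have [a ea] := connected_in_span connM Se S1.
have [|B' repB tdB] := IH R.
  by apply: leq_trans rkR; rewrite mdelete_restrict mrank_restrict_le.
pose B i y := if y == e then \sum_(z in ground M :\ e) a z * B' i z else B' i y.
exists B.
  (* Substituting the combination for [vec M e] spreads its coefficient over the other elements; the
     same substitution holds in each row of the matrix. *)
  move=> c; pose c' y := c y + c e * a y.
  have rel : relation M c <-> relation (mdelete M e) c'.
    rewrite /relation /= (big_setD1 e) //= ea scaler_sumr -big_split /=.
    by under eq_bigr => y _ do rewrite scalerA -scalerDl addrC.
  have row i : \sum_(y in ground M) c y * B i y = \sum_(y in ground M :\ e) c' y * B' i y.
    rewrite (big_setD1 e) //= /B eqxx mulr_sumr -big_split /=.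
    by apply: eq_bigr => y /setD1P[/negPf-> _]; rewrite mulrA -mulrDl addrC.
  rewrite rel (repB c'); split=> c0 i Ri; first by rewrite row; apply: c0.
  by rewrite -row; apply: c0.
rewrite csddM; apply: (@TdRoot _ _ _ _ (inr e)); first by rewrite inE.
rewrite (_ : _ :\ _ = vertices R (ground M :\ e)).
  apply: td_le_sub tdB => -[i|x] [j|y]; rewrite !inE //= /B.
    by move=> _ /andP[/negPf->].
  by move=> /andP[/negPf->].
by apply/setP=> -[i|y]; rewrite !inE.
Qed.

Lemma depth_representable_quotient M (L : {vspace ambient M}) :
    mrank M != 0%N -> \dim L = 1%N ->
    csdd M = (csdd (mquotient L)).+1 -> depth_representable (mquotient L) ->
  depth_representable M.
Proof.
move=> rkM dL csddM IH R rkR; have rkL := mrank_mquotient L.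
set U := <<_>>%VS in rkL.
have inU c : \sum_(e in ground M) c e *: vec M e \in U.
  by apply/mem_span_family; exists c.
(* A line outside the span of M leaves the relations unchanged, so a matrix of the quotient already
   represents M. Otherwise the rank drops, and [R :\ r] is large enough for the quotient. *)
have [UL0|UL] := eqVneq (U :&: L)%VS 0%VS.
  have [|B repB tdB] := IH R; first by rewrite UL0 dimv0 add0n in rkL; rewrite rkL.
  exists B; last by apply: td_le_mono tdB; rewrite csddM.
  move=> c; rewrite -(repB c) relation_mquotient /relation; split=> [->|Lc].
    exact: mem0v.
  by apply/eqP; rewrite -memv0 -UL0 memv_cap inU.
have [r Rr] : exists r, r \in R.
  by apply/set0Pn; rewrite -card_gt0; apply: leq_trans rkR; rewrite lt0n.
pose v := vpick L.
have v0 : v != 0 by rewrite vpick0 -dimv_eq0 dL.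
have DL : L = <[v]>%VS.
  by apply/esym/eqP; rewrite eqEdim dim_vline v0 dL andbT -memvE memv_pick.
(* A linear functional on the whole ambient space with value 1 at v: a combination that lies in L
   and is killed by phi must be 0. *)
pose phi := coord [tuple v] ord0.
have phiv : phi v = 1.
  have frv : free [tuple v] by rewrite seq1_free.
  exact: (@coord_free _ _ _ [tuple v] ord0 ord0 frv).
have phiZ a u : phi (a *: u) = a * phi u by rewrite /phi linearZ.
have phiE c : phi (\sum_(e in ground M) c e *: vec M e) =
    \sum_(e in ground M) c e * phi (vec M e).
  by rewrite /phi linear_sum; apply: eq_bigr => e _; rewrite linearZ.
have [|B' repB tdB] := IH (R :\ r).
  rewrite -ltnS; apply: (@leq_trans (mrank M)); last first.
    by apply: leq_trans rkR _; rewrite (cardsD1 r R) Rr.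
  by rewrite -rkL -[(mrank _).+1]add1n leq_add2r lt0n dimv_eq0.
exists (fun i y => if i == r then phi (vec M y) else B' i y).
  move=> c; split=> [c0 i Ri | c0].
    have [_|ir] := eqVneq i r; first by rewrite -phiE c0 /phi linear0.
    apply: (repB c).1; last by rewrite in_setD1 ir.
    by apply/relation_mquotient; rewrite c0 mem0v.
  have : relation (mquotient L) c.
    apply/(repB c) => i /setD1P[ir Ri].
    by have := c0 i Ri; rewrite (negPf ir).
  move/relation_mquotient; rewrite DL => /vlineP[a ca].
  have := c0 r Rr; rewrite eqxx -phiE ca phiZ phiv mulr1 => a0.
  by rewrite /relation ca a0 scale0r.
rewrite csddM; apply: (@TdRoot _ _ _ _ (inl r)); first by rewrite inE.
rewrite (_ : _ :\ _ = vertices (R :\ r) (ground M)).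
  apply: td_le_sub tdB => -[i|x] [l|y]; rewrite !inE //=.
    by move=> /andP[/negPf->].
  by move=> _ /andP[/negPf->].
by apply/setP=> -[i|y]; rewrite !inE.
Qed.

Lemma csdd_depth_representable M : depth_representable M.
Proof.
have [n] := ubnP (csdd_measure M); elim: n M => // n IHn M; rewrite ltnS => le_n.
have [rk0|rkM] := eqVneq (mrank M) 0%N; first exact: depth_representable_rank0.
have [S1|S1] := eqVneq #|ground M| 1%N; first exact: depth_representable_single.
have [connM|nconn] := boolP (mconnected M); last first.
  apply: depth_representable_disconnected => // C /maxsetp/andP[sC connC].
  apply: IHn; apply: leq_trans le_n; rewrite /csdd_measure /= ltn_add2r.
  rewrite (setIidPr sC) proper_card // properEneq sC andbT.
  by apply: contraNneq nconn => DC; rewrite DC mrestrict_ground in connC.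
have [[e Se csddM]|[L dL csddM]] := csdd_connected connM rkM S1.
  apply: (depth_representable_delete connM Se S1 csddM); apply: IHn.
  apply: leq_trans le_n; rewrite /csdd_measure /= ltn_add2r.
  by rewrite [X in (_ < X)%N](cardsD1 e) Se.
apply: (depth_representable_quotient rkM dL csddM); apply: IHn.
apply: leq_trans le_n; rewrite /csdd_measure /= ltn_add2l dim_quotV dL subn1.
by rewrite prednK //; apply: leq_trans (rank_le_dim M); rewrite lt0n.
Qed.

End UpperBound.

(** * Row equivalence and linear relations *)

Section RowEquivalence.
Variable F : fieldType.

Definition right_kernel m n (A : 'M[F]_(m, n)) (c : 'I_n -> F) :=
  forall i, \sum_j c j * A i j = 0.

Lemma relation_column_matroid m n (A : 'M[F]_(m, n)) c :
  relation (column_matroid A) c <-> right_kernel A c.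
Proof.
rewrite /relation /=; split=> [c0 i|c0].
  have /(congr1 (fun u : 'cV_m => u i 0)) := c0; rewrite summxE mxE => Dsum.
  by rewrite -[RHS]Dsum; apply: eq_big => j; rewrite ?inE // => _; rewrite !mxE.
apply/colP=> i; rewrite summxE mxE -[RHS](c0 i).
by apply: eq_big => j; rewrite ?inE // => _; rewrite !mxE.
Qed.

Lemma row_operation_kernel m n (A B : 'M[F]_(m, n)) c :
  row_operation A B -> right_kernel A c <-> right_kernel B c.
Proof.
case=> [i j a ij|i a a0]; split=> c0 k.
- under eq_bigr => l _ do rewrite mxE.
  case: (k == i) => //; under eq_bigr => l _ do rewrite mulrDr mulrCA.
  by rewrite big_split -mulr_sumr /= !c0 mulr0 addr0.
- have rowN l : l != i -> \sum_x c x * A l x = 0.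
    move=> /negPf li; rewrite -[RHS](c0 l).
    by apply: eq_bigr => x _; rewrite mxE li.
  have [->|/rowN//] := eqVneq k i.
  have := c0 i; under eq_bigr => l _ do rewrite mxE eqxx mulrDr mulrCA.
  by rewrite big_split -mulr_sumr /= (rowN j) 1?eq_sym // mulr0 addr0.
- under eq_bigr => l _ do rewrite mxE.
  case: (k == i) => //; under eq_bigr => l _ do rewrite mulrCA.
  by rewrite -mulr_sumr c0 mulr0.
- have := c0 k; under eq_bigr => l _ do rewrite mxE.
  have [->|//] := eqVneq k i; under eq_bigr => l _ do rewrite mulrCA.
  by rewrite -mulr_sumr => /eqP; rewrite mulf_eq0 (negPf a0) => /eqP.
Qed.

Lemma row_equivalent_kernel m n (A B : 'M[F]_(m, n)) c :
  row_equivalent A B -> right_kernel A c <-> right_kernel B c.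
Proof.
elim=> [{}A {}B /row_operation_kernel//|//|{}A C {}B _ AC _ CB].
by rewrite AC.
Qed.

(** Row operations act from the left. This carries the reduction of an invertible P to the identity
    over to [P *m B] and B. *)
Lemma row_operation_mulmxr m n p (A B : 'M[F]_(m, n)) (C : 'M_(n, p)) :
  row_operation A B -> row_operation (A *m C) (B *m C).
Proof.
case=> [i j a ij|i a a0].
  rewrite [X in row_operation _ X](_ : _ =
      \matrix_(k, l) if k == i then (A *m C) i l + a * (A *m C) j l
                                      else (A *m C) k l); first exact: RowAdd.
  apply/matrixP=> k l; rewrite !mxE; under eq_bigr => x _ do rewrite mxE.
  case: (k == i) => //; rewrite mulr_sumr -big_split; apply: eq_bigr => x _ /=.
  by rewrite mulrDl mulrA.
rewrite [X in row_operation _ X](_ : _ = \matrix_(k, l) if k == i then a * (A *m C) i l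
                                    else (A *m C) k l); first exact: RowScale.
apply/matrixP=> k l; rewrite !mxE; under eq_bigr => x _ do rewrite mxE.
by case: (k == i) => //; rewrite mulr_sumr; apply: eq_bigr => x _; rewrite mulrA.
Qed.

Lemma row_equivalent_mulmxr m n p (A B : 'M[F]_(m, n)) (C : 'M_(n, p)) :
  row_equivalent A B -> row_equivalent (A *m C) (B *m C).
Proof.
elim=> [{}A {}B AB|{}A|{}A D {}B _ AD _ DB].
- exact/rt_step/row_operation_mulmxr.
- exact: rt_refl.
- exact: rt_trans AD DB.
Qed.

(** * Reduction of a square matrix with trivial kernel to the identity *)

Section GaussJordan.
Variable m : nat.
Implicit Types (P Q : 'M[F]_m) (k : nat).

Definition reduced_upto k P := forall i j : 'I_m, (j < k)%N -> P i j = (i == j)%:R.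

Lemma pivot_exists (k : 'I_m) P :
    (forall c, right_kernel P c -> forall j, c j = 0) -> reduced_upto k P ->
  exists2 i : 'I_m, (k <= i)%N & P i k != 0.
Proof.
move=> injP redP; apply: contrapT => nex.
have Pk0 (i : 'I_m) : (k <= i)%N -> P i k = 0.
  by move=> ki; apply: contrapT => /eqP Pik; apply: nex; exists i.
(* With no pivot, column k is a combination of the first k columns, which are unit vectors; c is the
   resulting nonzero kernel vector. *)
pose c (j : 'I_m) := if (j < k)%N then - P j k else (j == k)%:R.
have ker_c : right_kernel P c.
  move=> i; rewrite (bigD1 k) //= {1}/c ltnn eqxx mul1r.
  have [ik|ki] := ltnP i k.
    have ik' : i != k by apply: contraTneq ik => ->; rewrite ltnn.
    rewrite (bigD1 i) //= {1}/c ik (redP i i ik) eqxx mulr1 addrA subrr add0r.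
    rewrite big1 // => j /andP[/negPf jk /negPf ji]; rewrite /c.
    case: ifP => [jltk|_]; last by rewrite jk mul0r.
    by rewrite (redP i j jltk) eq_sym ji mulr0.
  rewrite Pk0 // add0r big1 // => j /negPf jk; rewrite /c.
  case: ifP => [jltk|_]; last by rewrite jk mul0r.
  rewrite (redP i j jltk) (_ : i == j = false) ?mulr0 //.
  by apply: contraTF jltk => /eqP<-; rewrite -leqNgt.
by have /eqP := injP c ker_c k; rewrite /c ltnn eqxx oner_eq0.
Qed.

(** Exchanging rows is not one of the operations; adding the pivot row i to row k serves instead,
    and since row i is zero in the first k columns, those stay reduced. *)
Lemma nonzero_pivot (k : 'I_m) P :
    (forall c, right_kernel P c -> forall j, c j = 0) -> reduced_upto k P ->
  exists Q, [/\ row_equivalent P Q, reduced_upto k Q & Q k k != 0].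
Proof.
move=> injP redP; have [i ki Pik] := pivot_exists injP redP.
have [Pkk|Pkk] := eqVneq (P k k) 0; last by exists P; split=> //; apply: rt_refl.
have ik : k != i by apply: contraTneq Pik => <-; rewrite Pkk eqxx.
exists (\matrix_(l, x) if l == k then P k x + 1 * P i x else P l x); split.
- exact/rt_step/RowAdd.
- move=> l j jk; rewrite mxE; have [->|_] := eqVneq l k; last exact: redP.
  rewrite !redP // mul1r (_ : i == j = false) ?addr0 //.
  by apply: contraTF jk => /eqP<-; rewrite -leqNgt.
- by rewrite mxE eqxx Pkk add0r mul1r.
Qed.

Lemma unit_pivot (k : 'I_m) P :
    (forall c, right_kernel P c -> forall j, c j = 0) -> reduced_upto k P ->
  exists Q, [/\ row_equivalent P Q, reduced_upto k Q & Q k k = 1].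
Proof.
move=> injP redP; have [Q [PQ redQ Qkk]] := nonzero_pivot injP redP.
exists (\matrix_(l, x) if l == k then (Q k k)^-1 * Q k x else Q l x); split.
- by apply: rt_trans PQ _; apply/rt_step/RowScale; rewrite invr_eq0.
- move=> l j jk; rewrite mxE; have [->|_] := eqVneq l k; last exact: redQ.
  rewrite (redQ k j jk) (_ : k == j = false) ?mulr0 //.
  by apply: contraTF jk => /eqP<-; rewrite ltnn.
- by rewrite mxE eqxx mulVf.
Qed.

Lemma clear_column (k : 'I_m) P (s : seq 'I_m) :
    reduced_upto k P -> P k k = 1 -> k \notin s ->
  exists Q, [/\ row_equivalent P Q, reduced_upto k Q, Q k k = 1 &
                {in s, forall i, Q i k = 0}].
Proof.
move=> redP Pkk; elim: s => [|i s IHs].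
  by move=> _; exists P; split=> //; apply: rt_refl.
rewrite inE negb_or eq_sym => /andP[ik /IHs[Q [PQ redQ Qkk Qs]]].
exists (\matrix_(l, x) if l == i then Q i x + - Q i k * Q k x else Q l x); split.
- by apply: rt_trans PQ _; apply/rt_step/RowAdd.
- move=> l j jk; rewrite mxE; have [->|_] := eqVneq l i; last exact: redQ.
  rewrite (redQ k j jk) (redQ i j jk) (_ : k == j = false) ?mulr0 ?addr0 //.
  by apply: contraTF jk => /eqP<-; rewrite ltnn.
- by rewrite mxE eq_sym (negPf ik).
- move=> l; rewrite inE mxE; have [->|_] /= := eqVneq l i; last exact: Qs.
  by rewrite Qkk mulr1 subrr.
Qed.

Lemma row_equivalent_reduced k P :
    (forall c, right_kernel P c -> forall j, c j = 0) -> (k <= m)%N ->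
  exists2 Q, row_equivalent P Q & reduced_upto k Q.
Proof.
move=> injP; elim: k => [|k IHk] lt_km; first by exists P; [apply: rt_refl|].
have [Q PQ redQ] := IHk (ltnW lt_km); pose k' := Ordinal lt_km.
have injQ c : right_kernel Q c -> forall j, c j = 0.
  by move=> /(row_equivalent_kernel c PQ); apply: injP.
have [Q1 [QQ1 redQ1 Q1kk]] := @unit_pivot k' Q injQ redQ.
have [|Q2 [QQ2 redQ2 Q2kk Q2k]] :=
  @clear_column k' Q1 [seq i <- enum 'I_m | i != k'] redQ1 Q1kk.
  by rewrite mem_filter eqxx.
exists Q2; first by apply: rt_trans PQ _; apply: rt_trans QQ1 QQ2.
move=> i j; rewrite ltnS leq_eqVlt => /predU1P[Dj|/redQ2//].
have -> : j = k' by apply: val_inj.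
have [->//|ik] := eqVneq i k'; apply: Q2k.
by rewrite mem_filter ik mem_enum.
Qed.

Lemma unitmx_row_equivalent P : P \in unitmx -> row_equivalent P 1%:M.
Proof.
move=> uP; have injP c : right_kernel P c -> forall j, c j = 0.
  move=> ker_c j; have : P *m \col_j c j = 0.
    apply/colP=> i; rewrite !mxE -[RHS](ker_c i).
    by apply: eq_bigr => x _; rewrite mxE mulrC.
  by move/(congr1 (mulmx (invmx P)))/colP/(_ j); rewrite mulKmx // mulmx0 !mxE.
have [Q PQ redQ] := row_equivalent_reduced injP (leqnn m).
suff <- : Q = 1%:M by [].
by apply/matrixP=> i j; rewrite redQ // mxE.
Qed.

End GaussJordan.

(** The columns of [cokermx D] lie in the kernel of D, so inclusion of kernels gives the reverse
    inclusion of row spaces. Equal row spaces give [A = P *m B] with P invertible. *)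
Lemma row_equivalent_same_kernel m n (A B : 'M[F]_(m, n)) :
  (forall c, right_kernel A c <-> right_kernel B c) -> row_equivalent A B.
Proof.
move=> kerAB.
have sub (C D : 'M[F]_(m, n)) :
    (forall c, right_kernel D c -> right_kernel C c) -> (C <= D)%MS.
  move=> sDC; rewrite submxE; apply/eqP/matrixP=> i j; rewrite !mxE.
  rewrite -[RHS](sDC (fun l => cokermx D l j) _ i).
    by apply: eq_bigr => l _; rewrite mulrC.
  move=> k; have /matrixP/(_ k j) := mulmx_coker D; rewrite !mxE => Dsum.
  by rewrite -[RHS]Dsum; apply: eq_bigr => l _; rewrite mulrC.
have /eqmxMunitP[P uP DA] : (A == B)%MS.
  by rewrite !sub // => c /kerAB.
rewrite DA -[X in row_equivalent _ X]mul1mx.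
exact/row_equivalent_mulmxr/unitmx_row_equivalent.
Qed.

End RowEquivalence.

Theorem theorem5 (F : fieldType) (m n : nat) (A : 'M[F]_(m, n)) (hn : (0 < n)%N) :
  tdI_star A = (csdd (column_matroid A) + 1)%N.
Proof.
set M := column_matroid A; rewrite addn1; apply/eqP; rewrite eqn_leq.
have kernelP (B : 'M[F]_(m, n)) :
    represents (fun i j => B i j) [set: 'I_m] M <-> row_equivalent A B.
  have rowsE c : {in [set: 'I_m], forall i, \sum_(j in ground M) c j * B i j = 0} <->
      right_kernel B c.
    have sumE i : \sum_(j in ground M) c j * B i j = \sum_j c j * B i j.
      by apply: eq_bigl => j; rewrite inE.
    by split=> c0 i; [rewrite -sumE c0 ?inE | rewrite sumE].
  split=> [repB|AB c].
    apply: row_equivalent_same_kernel => c.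
    by rewrite -relation_column_matroid -rowsE; apply: repB.
  by rewrite rowsE relation_column_matroid; apply: row_equivalent_kernel.
have allV : vertices [set: 'I_m] (ground M) = [set: 'I_m + 'I_n].
  by apply/setP=> -[i|j]; rewrite !inE.
apply/andP; split.
  (* All m rows are used; there are enough of them because the columns live in a space of dimension
     m. *)
  have [|B repB] := @csdd_depth_representable F 'I_m 'I_n M [set: 'I_m].
    rewrite cardsT card_ord; apply: leq_trans (rank_le_dim M) _.
    by rewrite dimvf /dim /= muln1.
  pose B' := \matrix_(i, j) B i j.
  have eqB : B = (fun i j => B' i j).
    by apply/funext=> i; apply/funext=> j; rewrite mxE.
  rewrite allV eqB in repB * => /treedepth_leE le_td; apply: leq_trans le_td.
  by apply: nat_min_le; exists B' => //; apply/kernelP.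
have [B /kernelP repB ->] := tdI_star_attained A.
have /treedepth_leE tdB := leqnn (tdI B).
apply: (csdd_lt_td_le tdB _ _ repB); last by rewrite allV.
(* The strict bound needs an element: a matrix without rows and columns has tree-depth 0. *)
by apply/set0Pn; exists (Ordinal hn); rewrite inE.
Qed.
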